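(* Let $0<\alpha<n$ and $1<p<q<\infty$, and let $\beta=n\big(\frac1p-\frac1q\big)$. Let $\Psi$ be a Young function with associate function $\bar\Psi\in B^\beta_{q'}$, and let $(u,\sigma)$ be a pair of weights on $\mathbb{R}^n$ with $(\sigma,u)\in A^\alpha_{q',p',\Psi}$. Then $$\|I_\alpha(\,\cdot\,\sigma)\|_{L^p(\sigma)\to L^{q,\infty}(u)}\lesssim [\sigma,u]_{A^\alpha_{q',p',\Psi}}\,\|M_{\beta,\bar\Psi}\|_{L^{q'}\to L^{p'}}.$$
   Context: A weight is a non-negative locally integrable function on $\mathbb{R}^n$; $r'=r/(r-1)$. All cubes have sides parallel to the axes. $I_\alpha f(x)=\int_{\mathbb{R}^n}\frac{f(y)}{|x-y|^{n-\alpha}}\,dy$. A Young function is a function $\Psi:[0,\infty)\to[0,\infty)$ that is continuous, convex and strictly increasing, with $\Psi(0)=0$ and $\Psi(t)/t\to\infty$ as $t\to\infty$; its associate function is the Young function $\bar\Psi(t)=\sup_{s>0}\{st-\Psi(s)\}$. For a cube $Q$, $\|f\|_{\Psi,Q}=\inf\{\lambda>0:\frac1{|Q|}\int_Q\Psi(|f|/\lambda)\,dx\le1\}$. For $0<\beta<n$, $M_{\beta,\Psi}f(x)=\sup_{Q\ni x}|Q|^{\beta/n}\|f\|_{\Psi,Q}$. For $a,b\in(1,\infty)$ with $1/b=1/a-\beta/n$, a Young function $\Theta$ is in $B^\beta_a$ if $\int_c^\infty\frac{\Theta(t)^{b/a}}{t^b}\frac{dt}{t}<\infty$ for some $c>0$.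 (With $a=q'$ and $\beta=n(1/p-1/q)$, $b=p'$.) For a pair of weights $(v,\tau)$ and exponents $1<a\le b<\infty$, $[v,\tau]_{A^\alpha_{a,b,\Psi}}=\sup_Q|Q|^{\frac\alpha n+\frac1b-\frac1a}\left(\frac1{|Q|}\int_Q v\,dx\right)^{1/b}\|\tau^{1/a'}\|_{\Psi,Q}$, and $(v,\tau)\in A^\alpha_{a,b,\Psi}$ means this is finite. Thus $[\sigma,u]_{A^\alpha_{q',p',\Psi}}=\sup_Q|Q|^{\frac\alpha n+\frac1q-\frac1p}\left(\frac1{|Q|}\int_Q\sigma\,dx\right)^{1/p'}\|u^{1/q}\|_{\Psi,Q}$. $\|g\|_{L^{q,\infty}(u)}=\sup_{t>0}t\,u(\{|g|>t\})^{1/q}$ with $u(E)=\int_E u\,dx$; $\|f\|_{L^p(\sigma)}=(\int|f|^p\sigma\,dx)^{1/p}$; $\|I_\alpha(\,\cdot\,\sigma)\|_{L^p(\sigma)\to L^{q,\infty}(u)}$ is the smallest $C$ with $\|I_\alpha(f\sigma)\|_{L^{q,\infty}(u)}\le C\|f\|_{L^p(\sigma)}$ for all (non-negative, by positivity) $f\in L^p(\sigma)$; $\|M_{\beta,\bar\Psi}\|_{L^{q'}\to L^{p'}}$ is the operator norm from $L^{q'}(\mathbb{R}^n)$ to $L^{p'}(\mathbb{R}^n)$ (Lebesgue measure). $A\lesssim B$ means $A\le cB$ with $c$ depending only on $n,\alpha,p,q$. *)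

(* Defs.v *)
From HB Require Import structures.
From mathcomp Require Import all_boot all_order all_algebra.
From mathcomp Require Import all_classical all_reals all_analysis.

Set Implicit Arguments.
Unset Strict Implicit.
Unset Printing Implicit Defensive.
Import Order.TTheory GRing.Theory Num.Theory.
Import numFieldNormedType.Exports.
Local Open Scope classical_set_scope.
Local Open Scope ring_scope.

(* The image of [lebesgue_measure \x m] under [(x, t) |-> x :: t]; iterating it
   gives the n-fold product of the one-dimensional Lebesgue measure. *)
Section lebesgue_cons.
Context {R : realType} {n : nat}.
Local Notation T k := (k.-tuple (measurableTypeR R)).
Variable m : {sigma_finite_measure set (T n) -> \bar R}.
Local Open Scope ereal_scope.

Definition tcons (z : measurableTypeR R * T n) : T n.+1 :=
  [the n.+1.-tuple (measurableTypeR R) of z.1 :: z.2].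

Lemma measurable_tcons : measurable_fun setT tcons.
Proof. exact: measurable_cons. Qed.

Definition lebesgue_cons : set (T n.+1) -> \bar R :=
  pushforward (lebesgue_measure \x m) tcons.

Let mtcons A : measurable A -> measurable (tcons @^-1` A).
Proof. by move=> mA; rewrite -[X in measurable X]setTI; exact: measurable_tcons. Qed.

Let lebesgue_cons0 : lebesgue_cons set0 = 0.
Proof. by rewrite /lebesgue_cons /pushforward preimage_set0 measure0. Qed.

Let lebesgue_cons_ge0 A : 0 <= lebesgue_cons A.
Proof. by rewrite /lebesgue_cons /pushforward measure_ge0. Qed.

Let lebesgue_cons_sigma_additive : semi_sigma_additive lebesgue_cons.
Proof.
move=> F mF tF mUF; rewrite /lebesgue_cons /pushforward preimage_bigcup.
apply: measure_semi_sigma_additive => [i| |]; first exact: mtcons.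
- apply/trivIsetP => /= i j _ _ ij; rewrite -preimage_setI.
  by move/trivIsetP : tF => /(_ _ _ _ _ ij) ->//; rewrite preimage_set0.
- by rewrite -preimage_bigcup; exact: mtcons.
Qed.

HB.instance Definition _ := isMeasure.Build _ _ _ lebesgue_cons
  lebesgue_cons0 lebesgue_cons_ge0 lebesgue_cons_sigma_additive.

Let tuncons (t : T n.+1) : measurableTypeR R * T n :=
  (tnth t ord0, [tuple of behead t]).

Let measurable_tuncons : measurable_fun setT tuncons.
Proof.
apply: measurable_fun_pair; last exact: measurable_behead.
exact: measurable_tnth.
Qed.

Let tconsK : cancel tcons tuncons.
Proof. by move=> [x t]; congr (_, _); apply: val_inj. Qed.

Let lebesgue_cons_sigma_finite : sigma_finite setT lebesgue_cons.
Proof.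
have /sigma_finiteP[F [TF ndF Foo]] := sigma_finiteT (@lebesgue_measure R).
have /sigma_finiteP[G [TG ndG Goo]] := sigma_finiteT m.
exists (fun i => tuncons @^-1` (F i `*` G i)).
  rewrite -preimage_bigcup -(preimage_setT tuncons); congr (_ @^-1` _).
  rewrite -setXTT TF TG predeqE => -[x y]; split; last first.
    by move=> [i _ []/= ? ?]; split; exists i.
  move=> [/= [i _ Fix] [k _ Gky]]; exists (maxn i k) => //; split.
  - by move: x Fix; exact/subsetPset/ndF/leq_maxl.
  - by move: y Gky; exact/subsetPset/ndG/leq_maxr.
move=> i; have [mF Fi] := Foo i; have [mG Gi] := Goo i; split.
  rewrite -[X in measurable X]setTI; apply: measurable_tuncons => //.
  exact: measurableX.
rewrite /lebesgue_cons /pushforward -comp_preimage.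
rewrite (_ : _ \o _ = id); last by apply/funext => z /=; rewrite tconsK.
by rewrite preimage_id product_measure1E// lte_mul_pinfty// ge0_fin_numE.
Qed.

HB.instance Definition _ := Measure_isSigmaFinite.Build _ _ _ lebesgue_cons
  lebesgue_cons_sigma_finite.

End lebesgue_cons.

Fixpoint borel_lebesgue (R : realType) (n : nat) :
    {sigma_finite_measure set (n.-tuple (measurableTypeR R)) -> \bar R} :=
  if n is k.+1 then lebesgue_cons (borel_lebesgue R k)
  else dirac [tuple].

(* R^n with the sigma-algebra of Lebesgue measurable sets: the Caratheodory
   measurable sets of the outer measure induced by [borel_lebesgue R n]. *)
Definition Rn (R : realType) (n : nat) :=
  caratheodory_type ((borel_lebesgue R n)^*)%mu.
HB.instance Definition _ R n := Measurable.on (Rn R n).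

Definition lebesgue_Rn (R : realType) (n : nat) : set (Rn R n) -> \bar R :=
  @completed_measure_extension _ _ _ (borel_lebesgue R n).
HB.instance Definition _ R n := Measure.on (@lebesgue_Rn R n).

Lemma lebesgue_Rn_sigma_finite R n : sigma_finite setT (@lebesgue_Rn R n).
Proof. exact/completed_measure_extension_sigma_finite/sigma_finiteT. Qed.
HB.instance Definition _ R n := Measure_isSigmaFinite.Build _ _ _
  (@lebesgue_Rn R n) (@lebesgue_Rn_sigma_finite R n).

Section definitions.
Context {R : realType} {n : nat}.
Local Notation mu := (@lebesgue_Rn R n).
Local Notation dim := (n%:R : R).
Implicit Types (f g v w tau : Rn R n -> R) (Q : set (Rn R n)) (Psi : R -> R).
Implicit Types (x y : Rn R n).

Definition conj_exp (r : R) : R := r / (r - 1).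

Definition euclid_dist x y : R :=
  Num.sqrt (\sum_(i < n) (tnth x i - tnth y i) ^+ 2).

Definition cube Q : Prop := exists (a : Rn R n) (l : R), 0 < l /\
  Q = [set x | forall i, tnth a i <= tnth x i <= tnth a i + l].

(* Every compact set lies in a cube, so integrability over all (closed) cubes is
   local integrability. *)
Definition weight w : Prop :=
  [/\ measurable_fun setT w, forall x, 0 <= w x &
      forall Q, cube Q -> mu.-integrable Q (EFin \o w)].

Definition average Q (h : Rn R n -> \bar R) : \bar R :=
  ((fine (mu Q))^-1%:E * \int[mu]_(x in Q) h x)%E.

(* Young functions live on [0, +oo[; the values of [Psi] on negative reals are
   irrelevant everywhere below. *)
Definition young_function Psi : Prop :=
  [/\ {within `[0, +oo[, continuous Psi},
      convex_function (`[0, +oo[%classic : set R) Psi,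
      {in `[0, +oo[ &, {homo Psi : s t / s < t}},
      Psi 0 = 0 &
      Psi t / t @[t --> +oo] --> +oo].

(* The supremum is finite for t >= 0 because [Psi s / s] tends to +oo. *)
Definition associate Psi (t : R) : R :=
  sup [set s * t - Psi s | s in [set s | 0 < s]].

Definition luxemburg Psi Q f : \bar R :=
  ereal_inf [set l%:E | l in [set l : R | 0 < l /\
    (average Q (fun x => (Psi (`|f x| / l))%:E) <= 1)%E]].

Definition orlicz_maximal (beta : R) Psi f x : \bar R :=
  ereal_sup [set (mu Q `^ (beta / dim) * luxemburg Psi Q f)%E |
    Q in [set Q | cube Q /\ Q x]].

(* The exponent b is the one determined by 1/b = 1/a - beta/n. *)
Definition B_class (beta a : R) (Theta : R -> R) : Prop :=
  let b := (a^-1 - beta / dim)^-1 in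
  exists2 c : R, 0 < c &
    (\int[lebesgue_measure]_(t in `[c, +oo[)
      ((Theta t `^ (b / a) / t `^ b) / t)%:E < +oo)%E.

Definition two_weight_const (alpha a b : R) Psi v tau : \bar R :=
  ereal_sup [set (mu Q `^ (alpha / dim + b^-1 - a^-1)
    * average Q (EFin \o v) `^ b^-1
    * luxemburg Psi Q (fun x => (tau x `^ (conj_exp a)^-1)%R))%E | Q in cube].

(* On the diagonal the quotient is [f y / 0 = 0] instead of infinite, which only
   affects the null set [y = x]. *)
Definition riesz_potential (alpha : R) f x : \bar R :=
  \int[mu]_y (f y / euclid_dist x y `^ (dim - alpha))%:E.

Definition Lp_norm (p : R) w f : \bar R :=
  ((\int[mu]_x (`|f x| `^ p * w x)%:E) `^ p^-1)%E.

Definition weak_Lq_norm (q : R) w (h : Rn R n -> \bar R) : \bar R :=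
  ereal_sup [set
    (t%:E * (\int[mu]_(x in [set x | t%:E < `|h x|]) (w x)%:E) `^ q^-1)%E |
    t in [set t : R | 0 < t]].

(* Equal to +oo when no real constant C works. *)
Definition op_norm (D : set (Rn R n -> R)) (N1 : (Rn R n -> R) -> \bar R)
    (N2 : (Rn R n -> \bar R) -> \bar R)
    (T : (Rn R n -> R) -> Rn R n -> \bar R) : \bar R :=
  ereal_inf [set C%:E | C in [set C : R | 0 <= C /\
    forall f, D f -> (N1 f < +oo -> N2 (T f) <= C%:E * N1 f)%E]].

Definition riesz_weak_norm (alpha p q : R) (sigma u : Rn R n -> R) : \bar R :=
  op_norm [set f : Rn R n -> R | measurable_fun setT f /\ forall x, 0 <= f x]
    (Lp_norm p sigma) (weak_Lq_norm q u)
    (fun f => riesz_potential alpha (fun x => f x * sigma x)).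

Definition orlicz_maximal_norm (beta a b : R) Psi : \bar R :=
  op_norm [set f : Rn R n -> R | measurable_fun setT f]
    (fun f => ('N[mu]_(a%:E)[EFin \o f])%E) (fun h => ('N[mu]_(b%:E)[h])%E)
    (orlicz_maximal beta Psi).

End definitions.

(* Main.v *)
Require Import Defs.
From HB Require Import structures.
From mathcomp Require Import all_boot all_order all_algebra.
From mathcomp Require Import all_classical all_reals all_analysis.
From mathcomp Require Import measurable_realfun.
From mathcomp Require Import ring lra zify.

(** The estimate follows by duality from a bound for [I_alpha] on the functions
    [u 1_E]. If [I_alpha (f sigma) > s] on [E] and [u(E)] is finite, then
      [s u(E) <= int_E I_alpha(f sigma) u = int f sigma I_alpha(u 1_E)
              <= ||f||_{L^p(sigma)} ||I_alpha(u 1_E)||_{L^p'(sigma)}],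
    so the weak type inequality holds as soon as
      [||I_alpha(u 1_E)||_{L^p'(sigma)} <= c A N u(E)^(1/q')],
    where [A] is the two-weight constant and [N] the norm of the Orlicz maximal
    operator: divide by [u(E)^(1/q')].

    The kernel of [I_alpha] is dominated by the kernels of dyadic operators
      [g |-> sum_i a_i g(Q_i(x))], [a_i = |Q_i|^(alpha/n - 1)],
    over finitely many grids and scales, [Q_i(x)] being the cell of scale [i] that
    contains [x]: any two points lie in a common cell of comparable size of one of the
    grids shifted by thirds ([gcell_third], [riesz_le_truncated]).

    For one grid put [g = u 1_E] and [G = u(E)], and fix [1/2 <= theta < 1] large
    enough that [a_{i+1} <= theta^2 a_i]. Say that the mass drops at
    [x] at scale [i] if [g(Q_{i-1}(x)) <= theta g(Q_i(x))]. Three facts carry the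
    proof.
    - By the decay of [a_i] the scales without a drop are absorbed by those with
      a drop, and on the latter [g(Q_i(x))] decreases geometrically
      ([sum_powR_le_drops]).
    - A cell has at most one child of mass larger than [theta] times its own, so
      the mass drops on at least half of the cell ([drops_half]).
    - Sort the cells by the level [theta^(j+1) G < g(Q) <= theta^j G] of their
      mass. A point sees at most one drop in each level
      ([in_level_drops_uniq]); this replaces a sparse family.
    The cells of one level split into chains below disjoint maximal cells [V].
    The generalized Hoelder inequality and the two-weight condition
    ([cube_estimate]) give, for a cell [Q] of the chain of [V],
      [(a_i g(Q))^p' sigma(Q)
         <= (2 A)^p' |Q| (|Q|^(beta/n) ||u^(1/q') 1_(E cap V)||_Q)^p'],
    and by the two facts on drops the right-hand sides add up to at most twice
    [(2 A)^p' int M(u^(1/q') 1_(E cap V))^p' <= (2 A N)^p' g(V)^(p'/q')]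
    ([chain_estimate]). Here [p < q] enters: [p'/q' > 1], so summing over the
    disjoint tops [V], of mass at most [theta^j G], produces the factor
    [(theta^j G)^(p'/q' - 1)] ([level_estimate]), which can be summed over [j]
    ([mass_estimate]).

    When [A = 0] the right-hand side of the theorem vanishes even if the maximal
    operator is unbounded. In that case one of the two weights is zero almost
    everywhere ([degenerate_weights]). *)

Import Order.TTheory GRing.Theory Num.Theory.
Import numFieldNormedType.Exports.
Set Implicit Arguments.
Unset Strict Implicit.
Unset Printing Implicit Defensive.
Local Open Scope classical_set_scope.
Local Open Scope ring_scope.

(** * Integrals and countable partitions *)

Section integral_facts.
Local Open Scope ereal_scope.
Context d (T : measurableType d) (R : realType).
Variable mu : {measure set T -> \bar R}.

(** Only the definition of the integral as a supremum over simple functions is used, so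
    that [g] can be a maximal function, a supremum over uncountably many cubes. *)
Lemma le_integral_ge0 (D : set T) (f g : T -> \bar R) :
  (forall x, D x -> 0 <= f x) -> (forall x, D x -> f x <= g x) ->
  \int[mu]_(x in D) f x <= \int[mu]_(x in D) g x.
Proof.
move=> f0 fg; have g0 x : D x -> 0 <= g x by move=> Dx; apply: le_trans (fg _ Dx); exact: f0.
rewrite !ge0_integralE//.
apply: ereal_sup_le => _ [h /= hf <-]; exists h => // x.
apply: (le_trans (hf x)); rewrite /patch; case: ifPn => // /set_mem Dx; exact: fg.
Qed.

Lemma le_integral_setS (D E : set T) (f : T -> \bar R) :
  D `<=` E -> (forall x, E x -> 0 <= f x) ->
  \int[mu]_(x in D) f x <= \int[mu]_(x in E) f x.
Proof.
move=> DE f0; rewrite integral_mkcond [leRHS]integral_mkcond.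
apply: le_integral_ge0 => x _; rewrite !/patch.
  by case: ifPn => // /set_mem /DE /f0.
case: ifPn => [/set_mem Dx|_]; first by rewrite ifT// inE; exact: DE.
by case: ifPn => // /set_mem /f0.
Qed.

(** The integrated form of Young's inequality. *)
Lemma integral_le_addM (D : set T) (mD : measurable D) (c : R) (g F H : T -> R) :
  (0 <= c)%R -> measurable_fun D F -> measurable_fun D H ->
  (forall x, 0 <= F x)%R -> (forall x, 0 <= H x)%R -> (forall x, 0 <= g x)%R ->
  (forall x, g x <= c * (F x + H x))%R ->
  \int[mu]_(x in D) (g x)%:E <= c%:E *
    (\int[mu]_(x in D) (F x)%:E + \int[mu]_(x in D) (H x)%:E).
Proof.
move=> c0 mF mH F0 H0 g0 gFH.
apply: (@le_trans _ _ (\int[mu]_(x in D) (c%:E * ((F x)%:E + (H x)%:E)))).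
  by apply: le_integral_ge0 => x _; rewrite -?EFinD -?EFinM lee_fin.
have mFE : measurable_fun D (fun x => (F x)%:E) by exact/measurable_EFinP.
have mHE : measurable_fun D (fun x => (H x)%:E) by exact/measurable_EFinP.
rewrite ge0_integralZl_EFin//.
- by rewrite ge0_integralD// => x _; rewrite lee_fin.
- by move=> x _; rewrite adde_ge0// lee_fin.
- exact: emeasurable_funD.
Qed.

End integral_facts.

Section cells.
Local Open Scope ereal_scope.
Context d (T : measurableType d) (R : realType).
Variable mu : {measure set T -> \bar R}.
Variables (I : countType) (c : T -> I).
Hypothesis mc : forall m, measurable (c @^-1` [set m]).

(** The sigma-algebra generated by a countable measurable partition. *)
Lemma measurable_fun_cell d' (U : measurableType d') (F : I -> U) :
  measurable_fun setT (F \o c).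
Proof.
move=> _ Y mY; rewrite setTI.
have -> : (F \o c) @^-1` Y =
    \bigcup_m (if F m \in Y then c @^-1` [set m] else set0).
  apply/seteqP; split => [x /= Yx|x [m /= _]]; last first.
    by case: ifPn => // /set_mem Ym /= cx; rewrite cx.
  by exists (c x) => //=; rewrite ifT// inE.
apply: countable_bigcupT_measurable => [|m]; first exact: countableP.
by case: ifPn.
Qed.

Lemma integral_cells (f : T -> \bar R) :
  measurable_fun setT f -> (forall x, 0 <= f x) ->
  \int[mu]_x f x = \sum_(i <oo)
    \int[mu]_(x in [set x | pickle (c x) = i]) f x.
Proof.
move=> mf f0.
pose F i : set T := [set x | pickle (c x) = i].
have FT : \bigcup_i F i = setT.
  by apply/seteqP; split => // x _; exists (pickle (c x)).
have mF i : measurable (F i).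
  rewrite -[X in measurable X]setTI.
  exact: (@measurable_fun_cell _ nat pickle measurableT [set i]).
rewrite -[in LHS]FT ge0_integral_bigcup ?FT//.
by move=> i j _ _ [x []] /= <- <-.
Qed.

(** The way in which all integrals are compared below: on a cell of the right scale
    the quantities that depend on the cell alone are constants. *)
Lemma le_integral_cells (f g : T -> \bar R) :
  measurable_fun setT f -> (forall x, 0 <= f x) ->
  measurable_fun setT g -> (forall x, 0 <= g x) ->
  (forall y, \int[mu]_(x in c @^-1` [set c y]) f x <=
             \int[mu]_(x in c @^-1` [set c y]) g x) ->
  \int[mu]_x f x <= \int[mu]_x g x.
Proof.
move=> mf f0 mg g0 fg; rewrite !integral_cells//.
apply: lee_nneseries => [i _ _|i _]; first exact: integral_ge0.
have [[y yi]|ne] := pselect (exists y, pickle (c y) = i).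
  have -> : [set x | pickle (c x) = i] = c @^-1` [set c y].
    apply/seteqP; split => x /=; rewrite -yi; last by move=> ->.
    by apply: (pcan_inj pickleK).
  exact: fg.
have -> : [set x | pickle (c x) = i] = set0.
  by apply/seteqP; split => // x xi; apply: ne; exists x.
by rewrite !integral_set0.
Qed.
End cells.

(** * Lebesgue measure of boxes and cubes *)

Section lebesgue_Rn_facts.
Context {R : realType} {n : nat}.
Local Notation mu := (@lebesgue_Rn R n).

Lemma measurable_Rn (A : set (Rn R n)) :
  measurable (A : set (n.-tuple (measurableTypeR R))) -> measurable A.
Proof. exact: caratheodory_measurable_mu_ext. Qed.

Lemma lebesgue_RnE (A : set (Rn R n)) :
  measurable (A : set (n.-tuple (measurableTypeR R))) ->
  mu A = borel_lebesgue R n A.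
Proof. by move=> mA; rewrite /lebesgue_Rn /completed_measure_extension measurable_mu_extE. Qed.

End lebesgue_Rn_facts.

Section boxes.
Context {R : realType}.

Definition box n (J : 'I_n -> set R) : set (n.-tuple (measurableTypeR R)) :=
  [set x | forall i, J i (tnth x i)].

Lemma measurable_box n (J : 'I_n -> set R) :
  (forall i, measurable (J i)) -> measurable (box J).
Proof.
move=> mJ.
have -> : box J = \bigcap_i ((fun x => tnth x i) @^-1` J i).
  by apply/seteqP; split => [x Jx i _|x Jx i]; [exact: Jx|exact: (Jx i)].
apply: fin_bigcap_measurable => // i _.
rewrite -[X in measurable X]setTI.
exact: (@measurable_tnth _ (measurableTypeR R) n i measurableT (J i) (mJ i)).
Qed.

(** Induction on the dimension, along the product that defines the measure. *)
Lemma borel_lebesgue_box n (J : 'I_n -> set R) (l : R) :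
  (forall i, measurable (J i)) ->
  (forall i, lebesgue_measure (J i) = l%:E) ->
  borel_lebesgue R n (box J) = (l ^+ n)%:E.
Proof.
elim: n J => [|n IH] J mJ lJ.
  rewrite /= diracE expr0 mem_set//.
  by case.
rewrite /= /lebesgue_cons /pushforward.
have -> : tcons @^-1` box J = J ord0 `*` box (fun i => J (lift ord0 i)).
  apply/seteqP; split => [[x t] /= Jx|[x t] /= [Jx Jt] i].
    split => [|i]; first exact: (Jx ord0).
    by have := Jx (lift ord0 i); rewrite tnthS.
  by case: (unliftP ord0 i) => [j ->|->//]; rewrite tnthS; exact: Jt.
rewrite product_measure1E; [|exact: mJ|exact: measurable_box].
by rewrite IH// [X in (X * _)%E](lJ ord0) -EFinM exprS.
Qed.

End boxes.

Section cubes.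
Context {R : realType} {n : nat}.
Local Notation mu := (@lebesgue_Rn R n).

Lemma lebesgue_Rn_box (J : 'I_n -> set R) (l : R) :
  (forall i, measurable (J i)) ->
  (forall i, lebesgue_measure (J i) = l%:E) -> mu (box J) = (l ^+ n)%:E.
Proof.
move=> mJ lJ; rewrite lebesgue_RnE; first exact: borel_lebesgue_box.
exact: measurable_box.
Qed.

Lemma measurable_Rn_box (J : 'I_n -> set R) :
  (forall i, measurable (J i)) -> measurable (box J : set (Rn R n)).
Proof. by move=> mJ; apply: measurable_Rn; exact: measurable_box. Qed.

Definition cube_at (a : Rn R n) (l : R) : set (Rn R n) :=
  [set x | forall i, tnth a i <= tnth x i <= tnth a i + l].

Lemma cube_at_box a l : cube_at a l = box (fun i => [set` `[tnth a i, tnth a i + l]]).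
Proof.
by apply/seteqP; split => x /= ax i; have := ax i; rewrite /= in_itv.
Qed.

Lemma cube_cube_at a l : 0 < l -> cube (cube_at a l).
Proof. by move=> l0; exists a, l. Qed.


Lemma measurable_cube_at a l : measurable (cube_at a l).
Proof. by rewrite cube_at_box; apply: measurable_Rn_box. Qed.

Lemma measurable_cube (Q : set (Rn R n)) : cube Q -> measurable Q.
Proof. by move=> [a [l [l0 ->]]]; exact: measurable_cube_at. Qed.

Lemma mu_cube_at a l : 0 < l -> mu (cube_at a l) = (l ^+ n)%:E.
Proof.
move=> l0; rewrite cube_at_box; apply: lebesgue_Rn_box => // i.
by rewrite lebesgue_measure_itv/= lte_fin ltrDl l0 -EFinD addrAC subrr add0r.
Qed.

End cubes.

(** * Dyadic grids shifted by thirds *)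

Section grid1.
Context {R : realType}.
Implicit Types (b : bool) (k m : int) (x y : R).

(** The sign alternates with the scale: this is what makes the grid shifted by a third
    nested, because twice [- 1/3] is [1/3] minus an integer (see [gidx_nested]). *)
Definition shift b k : R := if b then (-1) ^+ `|k|%N / 3 else 0.

Definition gidx b k x : int := Num.floor (x / 2 ^ k - shift b k).

Lemma two_powz_gt0 k : 0 < (2 : R) ^ k.
Proof. by rewrite exprz_gt0. Qed.

Lemma gidxP b k x m :
  (gidx b k x = m) <->
  (2 ^ k * (m%:~R + shift b k) <= x < 2 ^ k * (m%:~R + shift b k) + 2 ^ k).
Proof.
have k0 := two_powz_gt0 k.
have -> : 2 ^ k * (m%:~R + shift b k) + 2 ^ k =
    (m%:~R + 1 + shift b k) * 2 ^ k by ring.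
rewrite mulrC -ler_pdivlMr// -ltr_pdivrMr// -lerBrDr -ltrBlDr -intrD1.
by rewrite /gidx; split => [<-|xm]; [exact: floor_itv|exact: floor_def].
Qed.

Lemma shiftS b k : shift b (k + 1) = - shift b k.
Proof.
rewrite /shift; case: b; last by rewrite oppr0.
rewrite -mulNr; congr (_ / _).
case: k => n; first by rewrite -PoszD addn1 exprS mulN1r.
have -> : Negz n + 1 = - n%:Z by lia.
by rewrite abszN /= exprS mulN1r opprK.
Qed.

(** Passing from scale [k] to [k + 1] maps the rescaled coordinate [w] to
    [(w + 3 shift) / 2], and [3 shift] is an integer, so the integer part of the
    result depends on that of [w] only. *)
Lemma gidx_nested b k x y : gidx b k x = gidx b k y ->
  gidx b (k + 1) x = gidx b (k + 1) y.
Proof.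
have key (w w' : R) (e : int) : Num.floor w = Num.floor w' ->
    Num.floor ((w + e%:~R) / 2) = Num.floor ((w' + e%:~R) / 2).
  move=> ww'.
  have h (v : R) : Num.floor v = Num.floor w ->
      Num.floor ((v + e%:~R) / 2) = ((Num.floor w + e) %/ 2)%Z.
    move=> vw; apply: floor_def.
    have /andP[] := floor_itv v; rewrite vw => v1 v2.
    set d := (_ %/ _)%Z.
    have d1 : (2 * d <= Num.floor w + e)%R by rewrite /d; lia.
    have d2 : (Num.floor w + e + 1 <= 2 * (d + 1))%R by rewrite /d; lia.
    move: d1 d2; rewrite -!(ler_int R) !(intrD, intrM) => d1 d2.
    move: v1 v2; rewrite !(intrD, intrM) => v1 v2.
    by apply/andP; split; lra.
  by rewrite h// h.
move=> xy; rewrite /gidx !shiftS.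
pose e : int := if b then (-1) ^+ `|k|%N else 0.
have eE : e%:~R = 3 * shift b k :> R.
  rewrite /e /shift; case: b {e xy} => //; last by rewrite mulr0.
  by rewrite rmorphXn/= rmorphN1 mulrCA divff ?mulr1.
have h z : z / 2 ^ (k + 1) - - shift b k = (z / 2 ^ k - shift b k + e%:~R) / 2.
  rewrite eE expfzDr// expr1z; field.
  by rewrite gt_eqF// two_powz_gt0.
by rewrite !h; exact: key.
Qed.

(** If both grids separate [x] and [y] then an integer and an integer plus a third lie
    within distance less than a third of each other. *)
Lemma gidx_third k x y : `|x - y| < 2 ^ k / 3 ->
  gidx false k x = gidx false k y \/ gidx true k x = gidx true k y.
Proof.
have no1 (d : int) : d < 1 -> 0 < d -> False by lia.
have no2 (d : int) : d < 0 -> 0 < d + 1 -> False by lia.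
wlog xy : x y / x <= y => [h|].
  have [xy|/ltW yx] := leP x y; first exact: h.
  by rewrite distrC => /(h _ _ yx)[]->; [left|right].
rewrite ler0_norm ?subr_le0// => xy3.
have k0 := two_powz_gt0 k.
have jump b : gidx b k x <> gidx b k y ->
    x / 2 ^ k < (gidx b k y)%:~R + shift b k <= y / 2 ^ k.
  move=> ne; rewrite /gidx in ne *.
  set w := _ - _ in ne; set z := _ - _ in ne *.
  have wz : w <= z by rewrite lerB// ler_pM2r// invr_gt0.
  have lt : (Num.floor w + 1 <= Num.floor z)%R.
    rewrite lezD1 lt_neqAle; apply/andP; split; first exact/eqP.
    exact: le_floor.
  have /andP[_ w1] := floor_itv w; have /andP[z1 _] := floor_itv z.
  rewrite -(ler_int R) in lt.
  by move: w1 z1 lt; rewrite /w /z; lra.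
have [?|ne0] := pselect (gidx false k x = gidx false k y); first by left.
have [?|ne1] := pselect (gidx true k x = gidx true k y); first by right.
have /andP[a1 a2] := jump _ ne0; have /andP[b1 b2] := jump _ ne1.
have yx : y / 2 ^ k - x / 2 ^ k < 1 / 3.
  by rewrite -mulrBl ltr_pdivrMr//; lra.
move: a1 a2 b1 b2; set m := gidx false k y; set m' := gidx true k y => a1 a2 b1 b2.
have : (m - m')%:~R - shift true k < 1/3 :> R /\ - (1/3) < (m - m')%:~R - shift true k :> R.
  by rewrite intrB; move: a1 a2 b1 b2; rewrite {1 2}/shift; split; lra.
have : shift true k = 1/3 \/ shift true k = - (1/3).
  by rewrite /shift -signr_odd; case: odd; [right|left]; rewrite ?expr1 ?expr0; lra.
case=> -> [].
  move=> h1 h2; have : (m - m')%:~R < 1 :> R /\ (0 : R) < (m - m')%:~R by split; lra.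
  by rewrite ltrz1 ltr0z => -[] /no1 h /h.
move=> h1 h2; have : (m - m')%:~R < 0 :> R /\ (0 : R) < (m - m' + 1)%:~R.
  by rewrite (intrD _ _ 1); split; lra.
by rewrite ltrz0 ltr0z => -[] /no2 h /h.
Qed.
End grid1.

Section grid.
Context {R : realType} {n : nat}.
Local Notation mu := (@lebesgue_Rn R n).
Implicit Types (t : {ffun 'I_n -> bool}) (k : int) (m : {ffun 'I_n -> int}).
Implicit Types (x y : Rn R n).

Definition gcell t k x : {ffun 'I_n -> int} :=
  [ffun i => gidx (t i) k (tnth x i : R)].

Definition corner t k m : Rn R n :=
  [tuple (2 ^ k * ((m i)%:~R + shift (t i) k) : measurableTypeR R) | i < n].

Definition gcube t k m : set (Rn R n) := cube_at (corner t k m) (2 ^ k).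

Lemma gcell_box t k m : gcell t k @^-1` [set m] =
  box (fun i => [set` `[tnth (corner t k m) i, tnth (corner t k m) i + 2 ^ k[]).
Proof.
apply/seteqP; split => x /=.
  move=> xm i; rewrite /= in_itv/= tnth_mktuple; apply/gidxP.
  by rewrite -xm ffunE.
move=> xm; apply/ffunP => i; rewrite ffunE; apply/gidxP.
by have := xm i; rewrite /= in_itv/= tnth_mktuple.
Qed.

Lemma measurable_gcell t k m : measurable (gcell t k @^-1` [set m]).
Proof. by rewrite gcell_box; apply: measurable_Rn_box. Qed.

Lemma mu_gcell t k m : mu (gcell t k @^-1` [set m]) = ((2 ^ k) ^+ n)%:E.
Proof.
rewrite gcell_box; apply: lebesgue_Rn_box => // i.
by rewrite lebesgue_measure_itv/= lte_fin ltrDl two_powz_gt0 -EFinD addrAC subrr add0r.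
Qed.

Lemma mu_gcube t k m : mu (gcube t k m) = ((2 ^ k) ^+ n)%:E.
Proof. by rewrite mu_cube_at// two_powz_gt0. Qed.

Lemma gcell_sub t k m : gcell t k @^-1` [set m] `<=` gcube t k m.
Proof.
rewrite gcell_box => x xm i; have := xm i; rewrite /= in_itv/= => /andP[-> /ltW].
by [].
Qed.

Lemma gcell_nested t k x y : gcell t k x = gcell t k y ->
  gcell t (k + 1) x = gcell t (k + 1) y.
Proof.
move=> /ffunP xy; apply/ffunP => i; rewrite !ffunE; apply: gidx_nested.
by have := xy i; rewrite !ffunE.
Qed.

(** The grid is chosen coordinate by coordinate, whence the [2 ^ n] grids. *)
Lemma gcell_third k x y : (forall i, `|tnth x i - tnth y i| < 2 ^ k / 3 :> R) ->
  exists t, gcell t k x = gcell t k y.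
Proof.
move=> xy.
exists [ffun i => gidx false k (tnth x i) != gidx false k (tnth y i)].
apply/ffunP => i; rewrite !ffunE.
by have [//|] := eqVneq; case: (gidx_third (xy i)) => [->|//]; rewrite eqxx.
Qed.

End grid.

(** * Geometric sums along the scales *)

Section chain.
Context {R : realType}.
Variables (theta delta r : R).
Hypotheses (theta_gt0 : 0 < theta) (theta_lt1 : theta < 1).
Hypotheses (delta_gt0 : 0 < delta) (r_gt0 : 0 < r).
Variables (a T : nat -> R).
Hypotheses (a_ge0 : forall i, 0 <= a i) (aS : forall i, a i.+1 <= theta ^+ 2 * a i).
Hypotheses (T_ge0 : forall i, 0 <= T i) (TS : forall i, T i <= T i.+1).

(** The scale [0], the smallest one, always counts as a drop. *)
Definition mass_drop (i : nat) : bool := (i == 0)%N || (T i.-1 <= theta * T i).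

(** At a scale without a drop, [a i * T i] is at most [theta] times the term of the
    previous scale, so these terms are absorbed by the whole sum. *)
Lemma sum_le_drop N : \sum_(i < N) a i * T i <=
  (1 - theta)^-1 * \sum_(i < N | mass_drop i) a i * T i.
Proof.
have aT0 i : 0 <= a i * T i by rewrite mulr_ge0.
rewrite mulrC ler_pdivlMr ?subr_gt0//.
case: N => [|N]; first by rewrite !big_ord0 mul0r.
have SN0 N' : 0 <= \sum_(i < N') a i * T i by apply: sumr_ge0.
suff h : \sum_(i < N.+1) a i * T i <=
    \sum_(i < N.+1 | mass_drop i) a i * T i + theta * \sum_(i < N) a i * T i.
  have : theta * \sum_(i < N) a i * T i <= theta * \sum_(i < N.+1) a i * T i.
    by rewrite ler_pM2l// [leRHS]big_ord_recr/= lerDl.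
  by move: h; lra.
elim: N => [|N IH].
  by rewrite big_ord0 mulr0 addr0 [leRHS]big_mkcond !big_ord_recr !big_ord0.
rewrite [leLHS]big_ord_recr /= [X in _ <= X + _]big_mkcond [X in _ <= X + _]big_ord_recr /=.
rewrite -big_mkcond/= [X in theta * X]big_ord_recr/= mulrDr.
have TN : 0 <= theta * (a N * T N) by rewrite mulr_ge0// ltW.
case: ifPn => [_|]; first by move: IH TN; lra.
rewrite /mass_drop /= -ltNge => TT.
have : a N.+1 * T N.+1 <= theta * (a N * T N).
  apply: (@le_trans _ _ (theta ^+ 2 * a N * T N.+1)); first by rewrite ler_wpM2r.
  rewrite expr2 -!mulrA ler_pM2l// mulrCA ler_wpM2l//; exact: ltW.
by move: IH; lra.
Qed.

Lemma theta_powR_lt1 : theta `^ delta < 1.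
Proof.
have := @gt0_ltr_powR R _ delta_gt0 theta 1.
by rewrite !nnegrE powR1; apply => //; exact: ltW.
Qed.

(** The sum telescopes: at a drop [T i `^ delta] exceeds its predecessor by the fraction
    [1 - theta `^ delta] of itself. *)
Lemma sum_drop_powR N : \sum_(i < N.+1 | mass_drop i) T i `^ delta <=
  (1 - theta `^ delta)^-1 * T N `^ delta.
Proof.
have td1 := theta_powR_lt1.
have td0 : 0 < theta `^ delta by exact: powR_gt0.
rewrite mulrC ler_pdivlMr ?subr_gt0//.
elim: N => [|N IH].
  rewrite big_mkcond big_ord_recr big_ord0 /= add0r.
  by rewrite -[leRHS]mulr1 ler_wpM2l ?powR_ge0//; lra.
rewrite big_mkcond big_ord_recr -big_mkcond/= mulrDl.
have TN : T N `^ delta <= T N.+1 `^ delta.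
  by rewrite ge0_ler_powR ?nnegrE// ltW.
case: ifPn => [|_]; last by rewrite mul0r addr0 (le_trans IH).
rewrite /mass_drop /= => TT.
have : T N `^ delta <= theta `^ delta * T N.+1 `^ delta.
  rewrite -powRM//; last exact: ltW.
  by rewrite ge0_ler_powR ?nnegrE// ?mulr_ge0// ltW.
by move: IH; lra.
Qed.

Definition drop_const : R := (1 - theta)^-1 * (1 - theta `^ delta)^-1.

Lemma drop_const_gt0 : 0 < drop_const.
Proof.
rewrite mulr_gt0// invr_gt0 subr_gt0//.
exact: theta_powR_lt1.
Qed.

(** The term of a drop is at most the [r]-th root of the right-hand side times
    [(T i / G) `^ delta], and the latter have a bounded sum over the drops. *)
Lemma sum_powR_le_drops N (G : R) : 0 < G -> (forall i, T i <= G) ->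
  (\sum_(i < N) a i * T i) `^ r <= drop_const `^ r *
    \sum_(i < N | mass_drop i) (a i * T i) `^ r * (G / T i) `^ (delta * r).
Proof.
move=> G0 TG.
have aT0 i : 0 <= a i * T i by rewrite mulr_ge0.
set M := \sum_(i < N | mass_drop i) _.
have M0 : 0 <= M by apply: sumr_ge0 => i _; rewrite mulr_ge0 ?powR_ge0.
have K0 := drop_const_gt0.
have -> : M = (M `^ r^-1) `^ r by rewrite -powRrM mulVf ?gt_eqF// powRr1.
rewrite -powRM ?powR_ge0//; last exact: ltW.
apply: ge0_ler_powR; rewrite ?nnegrE; first exact: ltW.
- exact: sumr_ge0.
- by rewrite mulr_ge0 ?powR_ge0// ltW.
case: N @M M0 => [|N] M M0; first by rewrite big_ord0 mulr_ge0 ?powR_ge0// ltW.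
apply: (le_trans (sum_le_drop _)).
rewrite /drop_const -mulrA ler_pM2l ?invr_gt0 ?subr_gt0//.
have bound (i : 'I_N.+1) : mass_drop i ->
    a i * T i <= M `^ r^-1 * G `^ (- delta) * T i `^ delta.
  move=> di; have [Ti|Ti] := eqVneq (T i) 0.
    by rewrite Ti mulr0 !mulr_ge0 ?powR_ge0.
  have {}Ti : 0 < T i by rewrite lt_neqAle eq_sym Ti T_ge0.
  have : (a i * T i * (G / T i) `^ delta) `^ r <= M.
    rewrite powRM ?powR_ge0// -powRrM /M (bigD1 i)//= lerDl.
    by apply: sumr_ge0 => j _; rewrite mulr_ge0 ?powR_ge0.
  have r1 : 0 <= r^-1 by rewrite invr_ge0 ltW.
  move=> /(ge0_ler_powR r1); rewrite !nnegrE powR_ge0 => /(_ isT M0).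
  rewrite -powRrM mulfV ?gt_eqF// powRr1 ?mulr_ge0 ?powR_ge0//.
  have Gd : 0 < G `^ delta by exact: powR_gt0.
  have GT : (G / T i) `^ delta * T i `^ delta = G `^ delta.
    by rewrite -powRM ?divr_ge0 ?divfK ?gt_eqF// ltW.
  move=> h; rewrite (powRN G) [leRHS]mulrAC ler_pdivlMr// -GT mulrA.
  by rewrite ler_wpM2r ?powR_ge0.
apply: le_trans (ler_sum _ bound) _.
rewrite -mulr_sumr.
apply: le_trans (ler_wpM2l _ (sum_drop_powR N)) _; first by rewrite mulr_ge0 ?powR_ge0.
have -> : M `^ r^-1 * G `^ (- delta) * ((1 - theta `^ delta)^-1 * T N `^ delta)
  = (1 - theta `^ delta)^-1 * M `^ r^-1 * (T N `^ delta * G `^ (- delta)) by ring.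
rewrite -[leRHS]mulr1 ler_wpM2l//.
  by rewrite mulr_ge0 ?powR_ge0// invr_ge0 subr_ge0 ltW// theta_powR_lt1.
rewrite (powRN G) ler_pdivrMr ?powR_gt0// mul1r ge0_ler_powR// ?nnegrE//; exact: ltW.
Qed.
End chain.

(** * Young functions and Luxemburg norms *)

Section young.
Context {R : realType}.
Variable Psi : R -> R.
Hypothesis young : young_function Psi.
Local Notation Phi := (associate Psi).

Lemma young_le s t : 0 <= s -> s <= t -> Psi s <= Psi t.
Proof.
case: young => _ _ mono _ _ s0; rewrite le_eqVlt => /orP[/eqP->//|st].
by apply/ltW/mono; rewrite // in_itv/= andbT// (le_trans s0 (ltW st)).
Qed.

Lemma young_ge0 s : 0 <= s -> 0 <= Psi s.
Proof.
by move=> s0; case: young => _ _ _ P0 _; rewrite -P0; exact: young_le.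
Qed.

(** Convexity between [0] and [1]. *)
Lemma young_small s : 0 < s -> s < 1 -> Psi s <= s * Psi 1.
Proof.
case: young => _ cvx _ Psi0 _ s0 s1.
have /= := cvx (Itv01 (ltW s0) (ltW s1)) 1 0.
rewrite !inE /= !in_itv /= !lexx ler01 => /(_ isT isT).
rewrite [leRHS]convRE [conv _ _ _](_ : _ = s); last first.
  by apply: (etrans (convRE _ _ _)); rewrite /= mulr1 mulr0 addr0.
by rewrite /= Psi0 mulr0 addr0.
Qed.

(** Superlinear growth makes [s * t - Psi s] negative for large [s]. *)
Lemma associate_ub t : 0 <= t ->
  has_ubound [set s * t - Psi s | s in [set s | 0 < s]].
Proof.
move=> t0; case: young => _ _ _ _ /cvgryPge /(_ t) [S [Sr HS]].
exists (Num.max 1 S * t) => _ [s /= s0 <-].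
have [sS|sS] := leP s (Num.max 1 S).
  apply: (@le_trans _ _ (s * t)); last by rewrite ler_wpM2r.
  by rewrite gerBl young_ge0// ltW.
have : t <= Psi s / s by apply: HS; apply: le_lt_trans sS; rewrite le_max lexx orbT.
rewrite ler_pdivlMr// mulrC -subr_le0 => /le_trans; apply.
by rewrite mulr_ge0// le_max ler01.
Qed.

Lemma associate_ge s t : 0 < s -> 0 <= t -> s * t - Psi s <= Phi t.
Proof. by move=> s0 t0; apply: (ub_le_sup (associate_ub t0)); exists s. Qed.

(** The values [s * t - Psi s] with [s] close to [0] are close to [0]. *)
Lemma associate_ge0 t : 0 <= t -> 0 <= Phi t.
Proof.
move=> t0; apply/ler_addgt0Pl => e e0.
have P1 : 0 <= Psi 1 by exact: young_ge0.
(* small enough for [Psi s <= s * Psi 1 <= e] *)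
pose s := Num.min 2^-1 (e / (Psi 1 + 1)).
have s0 : 0 < s by rewrite lt_min invr_gt0 ltr0n/= divr_gt0// ltr_wpDl.
have s1 : s < 1 by rewrite gt_min invf_lt1// ltr1n.
have se : s * Psi 1 <= e.
  apply: (@le_trans _ _ (e / (Psi 1 + 1) * (Psi 1 + 1))); last first.
    by rewrite divfK// gt_eqF// ltr_wpDl.
  by rewrite ler_pM ?(ltW s0) ?lerDl// ge_min lexx orbT.
have := associate_ge s0 t0; have := young_small s0 s1.
have : 0 <= s * t by rewrite mulr_ge0// ltW.
by move: se; lra.
Qed.

Lemma young_ineq s t : 0 <= s -> 0 <= t -> s * t <= Psi s + Phi t.
Proof.
rewrite le_eqVlt => /orP[/eqP<-|s0] t0.
  by rewrite mul0r addr_ge0 ?young_ge0 ?associate_ge0.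
by rewrite -lerBlDl associate_ge.
Qed.

Lemma associate_le s t : 0 <= s -> s <= t -> Phi s <= Phi t.
Proof.
move=> s0 st; have t0 := le_trans s0 st.
apply: ge_sup; first by exists (1 * s - Psi 1), 1 => //=.
move=> _ [x /= x0 <-]; apply: le_trans (associate_ge x0 t0).
by rewrite lerB// ler_pM2l.
Qed.

End young.

Lemma measurable_nondecreasing_comp d (T : measurableType d) (R : realType)
    (Psi : R -> R) (f : T -> R) (l : R) : 0 < l ->
  (forall s t, 0 <= s -> s <= t -> Psi s <= Psi t) ->
  measurable_fun setT f -> measurable_fun setT (fun x => Psi (`|f x| / l)).
Proof.
move=> l0 mono mf.
pose F z := Psi (Num.max 0 z).
have mF : measurable_fun setT F.
  apply: nondecreasing_measurable => // s t st; apply: mono.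
    by rewrite le_max lexx.
  by rewrite ge_max !le_max lexx /= st orbT.
rewrite (_ : (fun x => _) = F \o (fun x => `|f x| / l)); last first.
  by apply/funext => x; rewrite /F /= max_r// divr_ge0// ltW.
apply: measurableT_comp => //; apply: measurable_funM => //.
exact: measurableT_comp.
Qed.

(** The real inequality behind [cube_estimate], when all the norms are finite; [v] is the
    measure of the cube, [B] and [L] the two Luxemburg norms, [s] and [tau] the masses. *)
Lemma cube_estimate_fin (R : realType) (v al ga r A B L s tau : R) :
  0 < v -> 0 < r -> 0 <= A -> 0 <= B -> 0 <= L -> 0 <= s -> 0 <= tau ->
  tau <= 2 * v * B * L -> v `^ (al + ga) * (s / v) `^ r^-1 * B <= A ->
  (v `^ (al - 1) * tau) `^ r * s <= (2 * A) `^ r * (v * (v `^ (- ga) * L) `^ r).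
Proof.
move=> v0 r0 A0 B0 L0 s0 tau0 tauBL HA.
have vE : forall x, 0 < v `^ x by move=> x; exact: powR_gt0.
have vD x y : v `^ (x + y) = v `^ x * v `^ y by rewrite powRD// (gt_eqF v0) implybT.
set X := (s / v) `^ r^-1 in HA.
have X0 : 0 <= X by exact: powR_ge0.
have sE : s = v * X `^ r.
  rewrite /X -powRrM mulVf ?gt_eqF// powRr1 ?divr_ge0 ?(ltW v0)//.
  by rewrite mulrC divfK// gt_eqF.
have step : v `^ (al - 1) * tau <= 2 * v `^ al * B * L.
  have -> : 2 * v `^ al * B * L = v `^ (al - 1) * (2 * v * B * L).
    by rewrite vD powR_inv1 ?(ltW v0)//; field; rewrite gt_eqF.
  by rewrite ler_pM2l.
apply: (@le_trans _ _ ((2 * v `^ al * B * L) `^ r * s)).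
  rewrite ler_wpM2r// ge0_ler_powR ?(ltW r0)// nnegrE ?mulr_ge0 ?powR_ge0//.
rewrite {1}sE mulrCA -powRM ?mulr_ge0 ?powR_ge0//.
rewrite [leRHS]mulrCA ler_pM2l// -powRM ?mulr_ge0 ?powR_ge0//.
rewrite ge0_ler_powR ?(ltW r0)// ?nnegrE ?mulr_ge0 ?powR_ge0//.
have key : v `^ al * X * B <= A * v `^ (- ga).
  have -> : v `^ al * X * B = v `^ (al + ga) * X * B * v `^ (- ga).
    by rewrite vD (powRN v ga); field; rewrite gt_eqF.
  by rewrite ler_wpM2r ?powR_ge0.
have -> : 2 * v `^ al * B * L * X = 2 * (v `^ al * X * B) * L by ring.
have -> : 2 * A * (v `^ (- ga) * L) = 2 * (A * v `^ (- ga)) * L by ring.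
by rewrite ler_wpM2r// ler_pM2l.
Qed.

Section luxemburg_facts.
Context {R : realType} {n : nat}.
Local Notation mu := (@lebesgue_Rn R n).
Implicit Types (f h : Rn R n -> R) (Q : set (Rn R n)).

Definition admissible (Psi : R -> R) Q f (l : R) : Prop :=
  0 < l /\ (average Q (fun x => (Psi (`|f x| / l))%:E) <= 1)%E.

Lemma luxemburgE Psi Q f : luxemburg Psi Q f = ereal_inf (EFin @` admissible Psi Q f).
Proof. by []. Qed.

Lemma admissible_integral (Psi : R -> R) Q f l (v : R) : 0 < v -> mu Q = v%:E ->
  admissible Psi Q f l ->
  (\int[mu]_(x in Q) (Psi (`|f x| / l))%:E <= v%:E)%E.
Proof.
move=> v0 Qv [_]; rewrite /average Qv/= => h.
have e : (v%:E * v^-1%:E)%E = 1%E :> \bar R by rewrite -EFinM divff ?gt_eqF.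
rewrite -[leRHS]mule1 -[leLHS]mul1e -{1}e -muleA lee_wpmul2l// lee_fin.
exact: ltW.
Qed.

Lemma luxemburg_ge0 Psi Q f : (0 <= luxemburg Psi Q f)%E.
Proof. by apply: le_ereal_inf_tmp => _ [l [l0 _] <-]; rewrite lee_fin ltW. Qed.

Variable Psi : R -> R.
Hypothesis young : young_function Psi.
Local Notation Phi := (associate Psi).
Variables (Q : set (Rn R n)) (v : R).
Hypotheses (mQ : measurable Q) (v0 : 0 < v) (Qv : mu Q = v%:E).
Variables (f h : Rn R n -> R).
Hypotheses (mf : measurable_fun setT f) (mh : measurable_fun setT h).
Hypotheses (f0 : forall x, 0 <= f x) (h0 : forall x, 0 <= h x).

(** Young's inequality for [f / l1] and [h / l2], averaged over the cube. *)
Lemma hoelder_admissible l1 l2 :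
  admissible Psi Q f l1 -> admissible Phi Q h l2 ->
  (\int[mu]_(x in Q) (f x * h x)%:E <= (2 * v * l1 * l2)%:E)%E.
Proof.
move=> a1 a2; have [l10 _] := a1; have [l20 _] := a2.
have i1 := admissible_integral v0 Qv a1; have i2 := admissible_integral v0 Qv a2.
have F0 x : 0 <= Psi (`|f x| / l1) by rewrite young_ge0// divr_ge0// ltW.
have H0 x : 0 <= Phi (`|h x| / l2) by rewrite associate_ge0// divr_ge0// ltW.
have mF : measurable_fun setT (fun x => Psi (`|f x| / l1)).
  by apply: measurable_nondecreasing_comp mf => //; exact: young_le.
have mH : measurable_fun setT (fun x => Phi (`|h x| / l2)).
  by apply: measurable_nondecreasing_comp mh => //; exact: associate_le.
have l12 : 0 <= l1 * l2 by rewrite mulr_ge0// ltW.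
apply: le_trans (integral_le_addM mu mQ l12 _ _ F0 H0 _ _) _.
- exact: measurable_funTS.
- exact: measurable_funTS.
- by move=> x; rewrite mulr_ge0.
- move=> x.
  have : (`|f x| / l1) * (`|h x| / l2) <= Psi (`|f x| / l1) + Phi (`|h x| / l2).
    by apply: young_ineq => //; rewrite divr_ge0// ltW.
  rewrite !ger0_norm// => hh.
  have -> : f x * h x = l1 * l2 * (f x / l1 * (h x / l2)).
    by field; rewrite !gt_eqF.
  by rewrite ler_wpM2l.
have -> : (2 * v * l1 * l2)%:E = ((l1 * l2)%:E * (v%:E + v%:E))%E.
  by rewrite -EFinD -EFinM; congr (_%:E); ring.
by apply: lee_wpmul2l; [rewrite lee_fin|exact: leeD].
Qed.

Lemma hoelder_luxemburg (B L : R) :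
  luxemburg Psi Q f = B%:E -> luxemburg Phi Q h = L%:E ->
  (\int[mu]_(x in Q) (f x * h x)%:E <= (2 * v * B * L)%:E)%E.
Proof.
move=> fB hL.
set I := (\int[mu]_(x in Q) _)%E.
have I0 : (0 <= I)%E by apply: integral_ge0 => x _; rewrite lee_fin mulr_ge0.
have [_ [l1 a1 _] _] : exists2 x, (EFin @` admissible Psi Q f) x & (x < B%:E + 1%:E)%E.
  by have := @lb_ereal_inf_adherent R (EFin @` admissible Psi Q f) 1 ltr01;
     rewrite -luxemburgE fB; apply.
have [_ [l2 a2 _] _] : exists2 x, (EFin @` admissible Phi Q h) x & (x < L%:E + 1%:E)%E.
  by have := @lb_ereal_inf_adherent R (EFin @` admissible Phi Q h) 1 ltr01;
     rewrite -luxemburgE hL; apply.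
have If : I \is a fin_num.
  rewrite ge0_fin_numE//; apply: le_lt_trans (hoelder_admissible a1 a2) _.
  exact: ltry.
have B0 : 0 <= B by rewrite -lee_fin -fB luxemburg_ge0.
have L0 : 0 <= L by rewrite -lee_fin -hL luxemburg_ge0.
have [tau Itau] : exists tau, I = tau%:E by exists (fine I); rewrite fineK.
have tauP l1' l2' : admissible Psi Q f l1' -> admissible Phi Q h l2' ->
    tau <= 2 * v * l1' * l2'.
  by move=> a1' a2'; have := hoelder_admissible a1' a2'; rewrite -/I Itau lee_fin.
have step1 l : admissible Phi Q h l -> tau <= 2 * v * B * l.
  move=> al; have l0 := al.1.
  have : ((tau / (2 * v * l))%:E <= luxemburg Psi Q f)%E.
    apply: le_ereal_inf_tmp => _ [l' al' <-]; rewrite lee_fin.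
    rewrite ler_pdivrMr ?mulr_gt0//.
    by have := tauP _ _ al' al; lra.
  by rewrite fB lee_fin ler_pdivrMr ?mulr_gt0//; lra.
rewrite Itau lee_fin; move: B0; rewrite le_eqVlt => /orP[/eqP B0|B0].
  by have := step1 _ a2; rewrite -B0 !mulr0 !mul0r.
have : ((tau / (2 * v * B))%:E <= luxemburg Phi Q h)%E.
  apply: le_ereal_inf_tmp => _ [l' al' <-]; rewrite lee_fin.
  rewrite ler_pdivrMr ?mulr_gt0//.
  by have := step1 _ al'; lra.
by rewrite hL lee_fin ler_pdivrMr ?mulr_gt0//; lra.
Qed.

(** The two-weight condition on one cube [Q], combined with the generalized Hoelder
    inequality for [f = u^(1/q)] and a function [h] with [f h = u 1_E] on a subset [C] of
    [Q]. The norms may be infinite: if that of [f] is, then [sigma] vanishes on [Q]. *)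
Lemma cube_estimate (al ga r A s tau : R) (sigma : Rn R n -> R) (C : set (Rn R n)) :
  0 < r -> 0 < A -> C `<=` Q -> (forall x, 0 <= sigma x) ->
  (mu Q `^ (al + ga) * average Q (EFin \o sigma) `^ r^-1 * luxemburg Psi Q f
    <= A%:E)%E ->
  (\int[mu]_(x in C) (f x * h x)%:E = tau%:E)%E ->
  (\int[mu]_(x in Q) (sigma x)%:E = s%:E)%E ->
  (((v `^ (al - 1) * tau) `^ r)%:E * \int[mu]_(x in C) (sigma x)%:E <=
   ((2 * A) `^ r)%:E * (v%:E * (mu Q `^ (- ga) * luxemburg Phi Q h) `^ r))%E.
Proof.
move=> r0 A0 CQ sigma0 HA tauE sE.
have s0 : 0 <= s.
  by rewrite -lee_fin -sE integral_ge0// => x _; rewrite lee_fin.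
have tau0 : 0 <= tau.
  by rewrite -lee_fin -tauE integral_ge0// => x _; rewrite lee_fin mulr_ge0.
have Cs : (\int[mu]_(x in C) (sigma x)%:E <= s%:E)%E.
  by rewrite -sE; apply: le_integral_setS => // x _; rewrite lee_fin.
apply: le_trans (lee_wpmul2l _ Cs) _; first by rewrite lee_fin powR_ge0.
have av : average Q (EFin \o sigma) = (s / v)%:E.
  by rewrite /average Qv sE /= -EFinM mulrC.
rewrite av Qv !poweR_EFin -!EFinM in HA *.
have := luxemburg_ge0 Phi Q h; case hL : (luxemburg Phi Q h) => [L| |] L0; last by [].
  have := luxemburg_ge0 Psi Q f; case fB : (luxemburg Psi Q f) => [B| |] B0; last by [].
    rewrite fB -EFinM lee_fin in HA; rewrite -[(_%:E * L%:E)%E]EFinM poweR_EFin -!EFinM lee_fin.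
    apply: (@cube_estimate_fin _ _ _ _ _ _ B) => //; first exact: ltW.
    have := hoelder_luxemburg fB hL; rewrite -lee_fin; apply: le_trans.
    rewrite -tauE; apply: le_integral_setS => // x _.
    by rewrite lee_fin mulr_ge0.
  have -> : s = 0.
    apply/eqP/negPn/negP => sn0; move: HA; rewrite fB gt0_muley ?leye_eq//.
    by rewrite lte_fin mulr_gt0 ?powR_gt0// divr_gt0// lt_neqAle eq_sym sn0.
  rewrite mulr0 -[(_%:E * L%:E)%E]EFinM poweR_EFin -!EFinM lee_fin.
  by rewrite mulr_ge0 ?powR_ge0// mulr_ge0 ?powR_ge0// ltW.
rewrite gt0_muley ?lte_fin ?powR_gt0// poweRyr ?gt_eqF//.
by rewrite !gt0_muley ?leey// lte_fin// powR_gt0// mulr_gt0.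
Qed.

End luxemburg_facts.

(** * Masses of nested cells *)

Lemma le_of_eq (R : realType) (x y : R) : x = y -> x <= y.
Proof. by move=> ->. Qed.

Section geometric.
Context {R : realType}.

Lemma nneseries_geometric_le (k z : R) : 0 <= k -> 0 <= z -> z < 1 ->
  (\sum_(j <oo) (k * z ^+ j)%:E <= (k / (1 - z))%:E)%E.
Proof.
move=> k0 z0 z1; have z1' : 0 < 1 - z by rewrite subr_gt0.
apply: lime_le.
  by apply: is_cvg_nneseries => j _ _; rewrite lee_fin mulr_ge0// exprn_ge0.
apply: nearW => m; rewrite sumEFin lee_fin -mulr_sumr ler_wpM2l//.
rewrite -[leRHS]mul1r ler_pdivlMr// big_mkord.
have -> : (\sum_(j < m) z ^+ j) * (1 - z) = 1 - z ^+ m.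
  elim: m => [|m IH]; first by rewrite big_ord0 expr0 mul0r subrr.
  by rewrite big_ord_recr /= mulrDl IH exprS; ring.
by rewrite gerBl exprn_ge0.
Qed.

Lemma geometric_level (theta G t : R) : 0 < theta -> theta < 1 -> 0 < t -> t <= G ->
  exists j, G * theta ^+ j.+1 < t <= G * theta ^+ j.
Proof.
move=> th0 th1 t0 tG; have G0 : 0 < G by exact: lt_le_trans tG.
have ex : exists j, G * theta ^+ j.+1 < t.
  have /cvgr0_norm_lt /(_ _ (divr_gt0 t0 G0)) [m _ mP] :
    theta ^+ x @[x --> \oo] --> 0 by apply: cvg_expr; rewrite gtr0_norm.
  exists m; have := mP m.+1 (leqnSn m).
  by rewrite gtr0_norm ?exprn_gt0// ltr_pdivlMr// mulrC.
case: (ex_minnP ex) => j jP jmin; exists j; rewrite jP /=.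
case: j jP jmin => [_ _|j _ jmin]; first by rewrite expr0 mulr1.
by rewrite leNgt; apply/negP => /jmin; rewrite ltnn.
Qed.

End geometric.

Section finite_esums.
Context {R : realType} {N : nat}.
Implicit Types (F : 'I_N -> \bar R) (i : 'I_N).
Local Open Scope ereal_scope.

Lemma lee_sum_term F i : (forall j, 0 <= F j) -> F i <= \sum_(j < N) F j.
Proof. by move=> F0; rewrite (bigD1 i)//= leeDl// sume_ge0. Qed.

Lemma sum_single_term F i : (forall j, j != i -> F j = 0) -> \sum_(j < N) F j = F i.
Proof. by move=> F0; rewrite (bigD1 i)//= big1 ?adde0. Qed.

End finite_esums.

Section mass.
Context d (T : measurableType d) (R : realType).
Variable mu : {measure set T -> \bar R}.
Variables (I : countType) (c : nat -> T -> I).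
Hypothesis mc : forall i m, measurable (c i @^-1` [set m]).
Hypothesis nested : forall i x y, c i x = c i y -> c i.+1 x = c i.+1 y.

Definition cell i (y : T) : set T := c i @^-1` [set c i y].

Lemma measurable_cell i y : measurable (cell i y).
Proof. exact: mc. Qed.

Lemma cell_nested i k x y : (i <= k)%N -> c i x = c i y -> c k x = c k y.
Proof.
elim: k => [|k IH]; first by rewrite leqn0 => /eqP->.
rewrite leq_eqVlt => /orP[/eqP->//|]; rewrite ltnS => ik xy.
by apply: nested; exact: IH.
Qed.

Lemma measurable_fun_cell3 d' (U : measurableType d') (F : I -> I -> I -> U) i j k :
  measurable_fun setT (fun x => F (c i x) (c j x) (c k x)).
Proof.
pose G (p : I * I * I) := F p.1.1 p.1.2 p.2.
rewrite (_ : (fun x => _) = G \o (fun x => (c i x, c j x, c k x)))//.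
apply: measurable_fun_cell => -[[m1 m2] m3].
rewrite (_ : _ @^-1` _ = (c i @^-1` [set m1] `&` c j @^-1` [set m2])
    `&` c k @^-1` [set m3]).
  by apply: measurableI; first exact: measurableI.
by apply/seteqP; split => x /=; [case=> <- <- <-|case=> -[<- <-] <-].
Qed.

Variable g : T -> R.
Hypotheses (mg : measurable_fun setT g) (g0 : forall x, 0 <= g x).
Variable G : R.
Hypothesis gG : (\int[mu]_x (g x)%:E)%E = G%:E.

Definition mass i (m : I) : R := fine (\int[mu]_(x in c i @^-1` [set m]) (g x)%:E)%E.

Let gE0 x : (0 <= (g x)%:E)%E. Proof. by rewrite lee_fin. Qed.
#[local] Hint Resolve gE0 : core.

Let mgE D : measurable_fun D (fun x => (g x)%:E).
Proof. by apply: measurable_funTS; exact/measurable_EFinP. Qed.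

Lemma massE i m : (\int[mu]_(x in c i @^-1` [set m]) (g x)%:E)%E = (mass i m)%:E.
Proof.
rewrite /mass fineK// ge0_fin_numE; last exact: integral_ge0.
apply: le_lt_trans (ltry G); rewrite -gG.
exact: le_integral_setS.
Qed.

Lemma mass_ge0 i m : 0 <= mass i m.
Proof. by rewrite -lee_fin -massE integral_ge0. Qed.

Lemma mass_le i m : mass i m <= G.
Proof. by rewrite -lee_fin -massE -gG; exact: le_integral_setS. Qed.

Lemma massS i x : mass i (c i x) <= mass i.+1 (c i.+1 x).
Proof.
rewrite -lee_fin -!massE; apply: le_integral_setS => // y /=; exact: nested.
Qed.

Lemma mass_homo i k x : (i <= k)%N -> mass i (c i x) <= mass k (c k x).
Proof.
elim: k => [|k IH]; first by rewrite leqn0 => /eqP->.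
rewrite leq_eqVlt => /orP[/eqP->//|]; rewrite ltnS => ik.
exact: le_trans (IH ik) (massS _ _).
Qed.

Variable theta : R.
Hypotheses (theta_half : 1/2 <= theta) (theta_lt1 : theta < 1).

Definition drops i x := mass_drop theta (fun i => mass i (c i x)) i.

(** Two distinct children of a cell are disjoint. *)
Lemma mass_children i x y : c i.+1 x = c i.+1 y -> c i x <> c i y ->
  mass i (c i x) + mass i (c i y) <= mass i.+1 (c i.+1 y).
Proof.
move=> xy ne; rewrite -lee_fin EFinD -!massE -ge0_integral_setU//=.
- apply: le_integral_setS => // z [] /= zx; last exact: nested.
  by rewrite -xy; exact: nested.
- by apply/disj_setPS => z [/= -> ].
Qed.

Variable v : nat -> R.
Hypotheses (v_gt0 : forall i, 0 < v i) (vS : forall i, 2 * v i <= v i.+1).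
Hypothesis mu_cell : forall i y, mu (cell i y) = (v i)%:E.

Lemma measurable_drops i : measurable [set x | drops i x].
Proof.
rewrite -[X in measurable X]setTI.
pose F m1 m2 (m3 : I) := (i == 0)%N || (mass i.-1 m1 <= theta * mass i m2).
exact: (@measurable_fun_cell3 _ bool F i.-1 i i measurableT [set true]).
Qed.

(** A point without a drop lies in a child of mass larger than [theta >= 1/2] times that
    of the cell. There is at most one such child, and it has at most half of the measure. *)
Lemma drops_half i y : ((v i)%:E <= 2%:E * mu (cell i y `&` [set x | drops i x]))%E.
Proof.
have md := measurable_drops i.
have mcy := measurable_cell i y.
have full : (forall x, cell i y x -> drops i x) ->
    ((v i)%:E <= 2%:E * mu (cell i y `&` [set x | drops i x]))%E.
  move=> h; rewrite (_ : _ `&` _ = cell i y) ?mu_cell.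
    by rewrite -EFinM lee_fin; have := v_gt0 i; lra.
  by apply/seteqP; split => [x []//|x cx]; split => //; exact: h.
case: i md mcy full => [|i] md mcy full; first exact: full.
have [/full//|/existsNP[x0 /not_implyP[cx0 /negP ndx0]]] :=
  pselect (forall x, cell i.+1 y x -> drops i.+1 x).
have {}ndx0 : theta * mass i.+1 (c i.+1 y) < mass i (c i x0).
  by move: ndx0; rewrite /drops /mass_drop /= -ltNge -cx0.
(* [x0] has no drop, so the points without a drop all lie in the child of [x0] *)
have sub : cell i.+1 y `<=` (cell i.+1 y `&` [set x | drops i.+1 x]) `|` cell i x0.
  move=> x cx; have [xx0|xx0] := pselect (c i x = c i x0); [by right|left].
  split => //=; apply/negPn/negP; rewrite /drops /mass_drop /= -ltNge cx => nd.
  have := @mass_children i x x0 (etrans cx (esym cx0)) xx0; rewrite cx0.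
  have : 0 <= mass i.+1 (c i.+1 y) by exact: mass_ge0.
  by move: ndx0 nd theta_half; nra.
have mx0 := measurable_cell i x0.
have : (mu (cell i.+1 y) <=
    mu (cell i.+1 y `&` [set x | drops i.+1 x]) + mu (cell i x0))%E.
  apply: le_trans (measureU2 _ _ _) => //; last exact: measurableI.
  apply: le_measure sub; rewrite inE//.
  by apply: measurableU => //; exact: measurableI.
rewrite !mu_cell.
case: (mu _) => [z| |]//=; rewrite -?EFinD -?EFinM ?lee_fin.
- by have := vS i; lra.
- by move=> _; rewrite gt0_muley ?leey// lte_fin.
Qed.

Variable N : nat.
Variables (sigma : T -> R) (a : nat -> R) (r rho K : R).
Hypotheses (msigma : measurable_fun setT sigma) (sigma0 : forall x, 0 <= sigma x).
Hypotheses (a0 : forall i, 0 <= a i) (rho1 : 1 <= rho) (K0 : 0 <= K).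
(* [W k V i m] stands for what the cell [m] of scale [i] contributes to the maximal
   function of the weight cut off to the cell [V] of scale [k] *)
Variable W : nat -> I -> nat -> I -> \bar R.
Hypothesis W0 : forall k V i m, (0 <= W k V i m)%E.
Hypothesis W_local : forall k i y, (i <= k)%N ->
  (((a i * mass i (c i y)) `^ r)%:E * \int[mu]_(x in cell i y) (sigma x)%:E <=
    (v i)%:E * W k (c k y) i (c i y))%E.
Hypothesis W_global : forall k y (D : T -> \bar R), measurable_fun setT D ->
  (forall x, 0 <= D x)%E ->
  (forall x, exists2 i, (i <= k)%N & (D x <= W k (c k y) i (c i x))%E) ->
  (\int[mu]_x D x <= (K * mass k (c k y) `^ rho)%:E)%E.

Section level.
Variables (b B : R).
Hypotheses (b0 : 0 <= b) (bB : theta * B <= b).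

Definition in_level i (m : I) : bool := b < mass i m <= B.

(** Just below a drop the mass is at most [theta * B <= b], so that no smaller scale is in
    the level. *)
Lemma in_level_drops_uniq x i k : in_level i (c i x) -> in_level k (c k x) ->
  drops i x -> drops k x -> i = k.
Proof.
have aux i' k' : (i' < k')%N -> in_level i' (c i' x) -> in_level k' (c k' x) ->
    drops k' x -> False.
  case: k' => // k' ik /andP[bi _] /andP[_ kB]; rewrite /drops /mass_drop /= => dk.
  have := @mass_homo i' k' x ik.
  have : theta * mass k'.+1 (c k'.+1 x) <= theta * B.
    by rewrite ler_wpM2l//; move: theta_half; lra.
  by move: dk bi bB; lra.
move=> li lk di dk; have [ik|ki|//] := ltngtP i k.
- by case: (aux i k).
- by case: (aux k i).
Qed.

(** [m] and [m1] are the cells of scales [k] and [k + 1] that contain a given point; [k] is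
    the top of the run of scales at which the point is in the level, truncated at [N]. *)
Definition is_top k (m m1 : I) : bool :=
  in_level k m && ((k.+1 == N) || ~~ in_level k.+1 m1).

Lemma in_level_between x i j k : (i <= j)%N -> (j <= k)%N ->
  in_level i (c i x) -> in_level k (c k x) -> in_level j (c j x).
Proof.
move=> ij jk /andP[bi _] /andP[_ kB]; apply/andP; split.
  by apply: lt_le_trans bi _; exact: mass_homo.
by apply: le_trans kB; exact: mass_homo.
Qed.

Lemma is_top_uniq x k k' : (k < N)%N -> (k' < N)%N ->
  is_top k (c k x) (c k.+1 x) -> is_top k' (c k' x) (c k'.+1 x) -> k = k'.
Proof.
have aux l l' : (l' < N)%N -> (l < l')%N -> is_top l (c l x) (c l.+1 x) ->
    is_top l' (c l' x) (c l'.+1 x) -> False.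
  move=> l'N ll' /andP[lel /orP[/eqP lN|/negP nl]] /andP[lel' _].
    by move: l'N ll'; rewrite -lN ltnS ltnNge => ->.
  by apply: nl; exact: (@in_level_between x l l.+1 l').
move=> kN k'N tk tk'; have [kk'|kk'|//] := ltngtP k k'.
- by case: (aux k k').
- by case: (aux k' k).
Qed.

Lemma is_top_exists x i : (i < N)%N -> in_level i (c i x) ->
  exists k, [/\ (i <= k)%N, (k < N)%N & is_top k (c k x) (c k.+1 x)].
Proof.
move=> iN li.
(* the largest scale in the level *)
have ex : exists k, (k < N)%N && in_level k (c k x) by exists i; rewrite iN.
have ub k : (k < N)%N && in_level k (c k x) -> (k <= N)%N by case/andP => /ltnW.
case: (ex_maxnP ex ub) => k /andP[kN lk] kmax.
exists k; split => //; first by apply: kmax; rewrite iN.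
rewrite /is_top lk /=; apply/orP.
have [kN1|kN1] := eqVneq k.+1 N; [by left|right].
apply/negP => lk1; have := kmax k.+1; rewrite lk1 andbT ltn_neqAle kN1 kN => /(_ isT).
by rewrite ltnn.
Qed.

Definition level_term i m : R := if in_level i m then (a i * mass i m) `^ r else 0.

Lemma level_term_ge0 i m : 0 <= level_term i m.
Proof. by rewrite /level_term; case: ifP => // _; rewrite powR_ge0. Qed.

(** On a cell [Q] of the chain the integral of [level_term i * sigma] is at most
    [|Q| W <= 2 |Q cap drops| W] by [W_local] and [drops_half]. At each point at most one
    of these bounds is present, so [W_global] applies to their sum. *)
Lemma chain_estimate k y : (\int[mu]_(x in cell k y)
    (\sum_(i < k.+1) level_term i (c i x) * sigma x)%:E <=
    (2 * (K * mass k (c k y) `^ rho))%:E)%E.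
Proof.
pose P i m m' V := [&& V == c k y, in_level i m &
  (i == 0)%N || (mass i.-1 m' <= theta * mass i m)].
pose H i x : \bar R :=
  if P i (c i x) (c i.-1 x) (c k x) then W k (c k y) i (c i x) else 0%E.
have H0 i x : (0 <= H i x)%E by rewrite /H; case: ifP.
have mH i : measurable_fun setT (H i).
  pose F m m' V := if P i m m' V then W k (c k y) i m else 0%E.
  exact: (@measurable_fun_cell3 _ _ F).
have HD : (\int[mu]_x \sum_(i < k.+1) H i x <= (K * mass k (c k y) `^ rho)%:E)%E.
  apply: W_global.
  - exact: emeasurable_sum.
  - by move=> x; exact: sume_ge0.
  - move=> x.
    have [[i0 /andP[_ Pi0]]|none] := pselect (exists i0 : 'I_k.+1,
        true && P i0 (c i0 x) (c i0.-1 x) (c k x)); last first.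
      exists 0%N => //; rewrite big1// => i _; rewrite /H.
      by case: ifP => // Pi; case: none; exists i.
    exists i0; first by rewrite -ltnS.
    rewrite (bigD1 i0)//= big1 ?adde0; first by rewrite /H Pi0.
    move=> i ii0; rewrite /H; case: ifP => // Pi.
    move: Pi Pi0 => /and3P[_ li di] /and3P[_ li0 di0].
    case/negP: ii0; apply/eqP/val_inj/eqP.
    by apply/eqP; exact: (@in_level_drops_uniq x).
rewrite EFinM; apply: le_trans (lee_wpmul2l _ HD); last by rewrite lee_fin.
rewrite ge0_integral_sum//.
under eq_integral do rewrite -sumEFin.
have mterm i : measurable_fun setT (fun x => (level_term i (c i x) * sigma x)%:E).
  apply/measurable_EFinP; apply: measurable_funM => //.
  exact: (@measurable_fun_cell _ _ _ _ (mc i) _ R (level_term i)).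
rewrite ge0_integral_sum//; last 3 first.
- exact: measurable_cell.
- by move=> i; exact: measurable_funTS.
- by move=> i x _; rewrite lee_fin mulr_ge0 ?level_term_ge0.
rewrite ge0_sume_distrr; last by move=> i _; exact: integral_ge0.
apply: lee_sum => i _; rewrite -ge0_integralZl_EFin//.
have ik : (i <= k)%N by rewrite -ltnS.
rewrite integral_mkcond.
apply: (le_integral_cells (mc i)).
- by apply/measurable_restrict => //; [exact: measurable_cell|rewrite setTI; exact: measurable_funTS].
- by move=> x; apply: erestrict_ge0 => z _; rewrite lee_fin mulr_ge0 ?level_term_ge0.
- exact: measurable_funeM.
- by move=> x; rewrite mule_ge0// lee_fin.
move=> z; rewrite -/(cell i z).
have [kzy|kzy] := eqVneq (c k z) (c k y); last first.
  rewrite integral0_eq.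
    by apply: integral_ge0 => x _; rewrite mule_ge0// lee_fin.
  move=> x xz; rewrite patchE ifF//; apply/negbTE/negP; rewrite inE /cell /= => xy.
  by move/eqP: kzy; apply; rewrite -xy; apply/esym; exact: (cell_nested ik).
have [lz|lz] := boolP (in_level i (c i z)); last first.
  rewrite integral0_eq.
    by apply: integral_ge0 => x _; rewrite mule_ge0// lee_fin.
  move=> x xz; rewrite patchE; case: ifP => // _.
  by rewrite xz /level_term (negbTE lz) mul0r.
rewrite (eq_integral (fun x => ((a i * mass i (c i z)) `^ r)%:E * (sigma x)%:E)%E); last first.
  move=> x; rewrite inE => xz; rewrite patchE ifT; last first.
    by rewrite inE /cell /= -kzy; exact: (cell_nested ik).
  by rewrite -EFinM xz /level_term lz.
have mci := measurable_cell i z.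
have msE : measurable_fun (cell i z) (fun x => (sigma x)%:E).
  by apply: measurable_funTS; exact/measurable_EFinP.
have sE0 x : cell i z x -> (0 <= (sigma x)%:E)%E by rewrite lee_fin.
rewrite (ge0_integralZl_EFin mu mci sE0 msE (powR_ge0 _ _)).
apply: (le_trans (W_local z ik)).
rewrite kzy.
have -> : (\int[mu]_(x in cell i z) (2%:E * H i x))%E =
    (\int[mu]_(x in cell i z `&` [set x | drops i x]) (2%:E * W k (c k y) i (c i z)))%E.
  rewrite integral_mkcondr; apply: eq_integral => x; rewrite inE => xz.
  rewrite patchE /H /P xz lz (cell_nested ik xz) kzy eqxx /= -xz.
  rewrite -/(mass_drop theta (fun i => mass i (c i x)) i) -/(drops i x).
  rewrite [x \in _](_ : _ = drops i x); last by apply/idP/idP; rewrite inE.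
  by case: (drops i x); rewrite ?mule0.
rewrite integral_cst; last by apply: measurableI => //; exact: measurable_drops.
rewrite muleAC lee_wpmul2r//.
exact: drops_half.
Qed.

(** The tops are disjoint and of mass at most [B], so the powers [rho] of their masses sum
    to at most [B `^ (rho - 1)] times the total mass. *)
Lemma level_estimate : (\int[mu]_x
    (\sum_(i < N) level_term i (c i x) * sigma x)%:E <=
    (2 * K * B `^ (rho - 1) * G)%:E)%E.
Proof.
have term0 i x : 0 <= level_term i (c i x) * sigma x.
  by rewrite mulr_ge0// level_term_ge0.
have mterm i : measurable_fun setT (fun x => (level_term i (c i x) * sigma x)%:E).
  apply/measurable_EFinP; apply: measurable_funM => //.
  exact: (@measurable_fun_cell _ _ _ _ (mc i) _ R (level_term i)).
pose S k x := (\sum_(i < k.+1) level_term i (c i x) * sigma x)%:E.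
have S0 k x : (0 <= S k x)%E by rewrite lee_fin sumr_ge0.
have mS k : measurable_fun setT (S k).
  rewrite /S; under eq_fun do rewrite -sumEFin.
  exact: emeasurable_sum.
pose top k x := is_top k (c k x) (c k.+1 x).
have mtop (k : nat) (f : T -> \bar R) : measurable_fun setT f ->
    measurable_fun setT (fun x => if top k x then f x else 0%E).
  move=> mf; apply: measurable_fun_ifT => //.
  exact: (@measurable_fun_cell3 _ bool (fun m m1 _ => is_top k m m1) k k.+1 k).
apply: (@le_trans _ _
    (\int[mu]_x \sum_(k < N) (if top k x then S k x else 0%E))%E).
  apply: le_integral_ge0 => x _; first by rewrite lee_fin sumr_ge0.
  have [[i0 li0]|none] := pselect (exists i : 'I_N, in_level i (c i x)); last first.
    rewrite big1; first by apply: sume_ge0 => k _; case: ifP.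
    move=> i _; rewrite /level_term ifF ?mul0r//; apply/negbTE/negP => li.
    by apply: none; exists i.
  have [k [_ kN tk]] := is_top_exists (ltn_ord i0) li0.
  apply: (@le_trans _ _ (S k x)); last first.
    have := @lee_sum_term _ _ (fun k : 'I_N => if top k x then S k x else 0%E)
      (Ordinal kN).
    by rewrite [top _ x]tk; apply => i; case: ifP.
  rewrite lee_fin [leRHS](big_ord_widen N (fun i => level_term i (c i x) * sigma x))//.
  rewrite [leRHS]big_mkcond/=; apply: ler_sum => i _; case: ifP => // /negP ik.
  rewrite /level_term; case: ifP => [li|]; last by rewrite mul0r.
  have [k' [ik' k'N tk']] := is_top_exists (ltn_ord i) li.
  by exfalso; apply: ik; rewrite ltnS (is_top_uniq kN k'N tk tk').
pose c1 := 2 * K * B `^ (rho - 1).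
have c10 : 0 <= c1 by rewrite !mulr_ge0 ?powR_ge0.
rewrite EFinM -gG -/c1.
apply: (@le_trans _ _ (\int[mu]_x \sum_(k < N)
    (if top k x then c1%:E * (g x)%:E else 0%E))%E); last first.
  rewrite -ge0_integralZl_EFin//.
  apply: le_integral_ge0 => x _.
    by apply: sume_ge0 => i _; case: ifP => // _; rewrite mule_ge0.
  have [[i0 ti0]|none] := pselect (exists i : 'I_N, top i x); last first.
    rewrite big1; first by rewrite mule_ge0.
    move=> i _; rewrite ifF//; apply/negbTE/negP => ti.
    by apply: none; exists i.
  rewrite (@sum_single_term _ _ _ i0) ?ti0// => i /eqP ii0.
  rewrite ifF//; apply/negbTE/negP => ti; apply/ii0/val_inj.
  exact: (is_top_uniq (ltn_ord i) (ltn_ord i0) ti ti0).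
have S'0 k x : (0 <= if top k x then S k x else 0)%E by case: ifP.
have R0 k x : (0 <= if top k x then c1%:E * (g x)%:E else 0)%E.
  by case: ifP => // _; rewrite mule_ge0.
have mcg : measurable_fun setT (fun x => c1%:E * (g x)%:E)%E.
  exact: measurable_funeM.
rewrite !ge0_integral_sum//; [|by move=> k; exact: mtop..].
apply: lee_sum => k _.
apply: (le_integral_cells (mc k)) => //; [exact: mtop|exact: mtop|].
move=> y; rewrite -/(cell k y).
have topE x : cell k y x -> top k x = top k y.
  by move=> xy; rewrite /top xy (nested xy).
have [ty|ty] := boolP (top k y); last first.
  rewrite integral0_eq; first by apply: integral_ge0.
  by move=> x xy; rewrite topE// (negbTE ty).
rewrite (eq_integral (S k)); last by move=> x; rewrite inE => xy; rewrite topE// ty.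
rewrite [leRHS](eq_integral (fun x => c1%:E * (g x)%:E)%E); last first.
  by move=> x; rewrite inE => xy; rewrite topE// ty.
rewrite ge0_integralZl_EFin//; last exact: measurable_cell.
apply: (le_trans (chain_estimate k y)).
rewrite /cell massE -EFinM lee_fin /c1.
have /andP[/andP[ybig yB] _] := ty.
have my0 : 0 < mass k (c k y) by exact: le_lt_trans ybig.
have -> : mass k (c k y) `^ rho = mass k (c k y) `^ (rho - 1) * mass k (c k y).
  rewrite -[X in _ * X]powRr1 ?(ltW my0)// -powRD ?subrK//.
  by rewrite (gt_eqF my0) implybT.
rewrite !mulrA ler_wpM2r ?(ltW my0)// ler_wpM2l ?mulr_ge0//.
by rewrite ge0_ler_powR ?nnegrE ?subr_ge0 ?(ltW my0)// (le_trans (ltW my0)).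
Qed.

End level.

(** [z] is the ratio of the geometric series over the levels: level [j] contributes
    [theta^(j (rho - 1))] by [level_estimate], and half of this is spent on the weights
    [(G / T i) `^ (delta * r)] of [sum_powR_le_drops], with [delta * r = (rho - 1) / 2]. *)
Definition levels_const : R :=
  let z := theta `^ ((rho - 1) / 2) in
  drop_const theta ((rho - 1) / (2 * r)) `^ r * (2 / z / (1 - z)).

(** The abstract form of the dual estimate. The terms [W] stand for the values of the
    maximal function: [W_local] is the one-cube estimate and [W_global] the boundedness
    of the maximal operator on the weight cut off to the cell [c k y]. *)
Lemma mass_estimate : 0 < r -> 1 < rho -> 0 < G ->
  (forall i, a i.+1 <= theta ^+ 2 * a i) ->
  (\int[mu]_x (((\sum_(i < N) a i * mass i (c i x)) `^ r) * sigma x)%:E <=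
   (levels_const * K * G `^ rho)%:E)%E.
Proof.
move=> r0 rho_gt1 G0 aS.
have th0 : 0 < theta by move: theta_half; lra.
pose eta := (rho - 1) / 2; have eta0 : 0 < eta by rewrite divr_gt0// subr_gt0.
pose delta := (rho - 1) / (2 * r).
have delta0 : 0 < delta by rewrite divr_gt0 ?mulr_gt0// subr_gt0.
have etaE : delta * r = eta by rewrite /delta /eta; field; rewrite gt_eqF.
pose z := theta `^ eta.
have z0 : 0 < z by exact: powR_gt0.
have z1 : z < 1 by exact: theta_powR_lt1.
have zX j : (theta ^+ j) `^ eta = z ^+ j.
  by rewrite -powR_mulrn ?(ltW th0)// powRAC powR_mulrn ?powR_ge0.
pose lev j := fun i m => level_term (G * theta ^+ j.+1) (G * theta ^+ j) i m.
pose cc := drop_const theta delta `^ r.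
have cc0 : 0 <= cc by exact: powR_ge0.
pose S j x := ((cc * (z ^+ j.+1)^-1) * \sum_(i < N) lev j i (c i x) * sigma x)%:E.
have lev0 j i m : 0 <= lev j i m by exact: level_term_ge0.
have S0 j x : (0 <= S j x)%E.
  rewrite lee_fin mulr_ge0// ?mulr_ge0 ?invr_ge0 ?exprn_ge0 ?(ltW z0)//.
  by apply: sumr_ge0 => i _; rewrite mulr_ge0.
have mlev j i : measurable_fun setT (fun x => (lev j i (c i x) * sigma x)%:E).
  apply/measurable_EFinP; apply: measurable_funM => //.
  exact: (@measurable_fun_cell _ _ _ _ (mc i) _ R (lev j i)).
have mS0 j : measurable_fun setT (fun x =>
    (\sum_(i < N) lev j i (c i x) * sigma x)%:E).
  by under eq_fun do rewrite -sumEFin; exact: emeasurable_sum.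
have mS j : measurable_fun setT (S j).
  by rewrite /S; under eq_fun do rewrite EFinM; exact: measurable_funeM.
apply: (@le_trans _ _ (\int[mu]_x \sum_(j <oo) S j x)%E).
  apply: le_integral_ge0 => x _; first by rewrite lee_fin mulr_ge0 ?powR_ge0.
  pose Tx i := mass i (c i x).
  have Tx0 i : 0 <= Tx i by exact: mass_ge0.
  have := @sum_powR_le_drops _ theta delta r th0 theta_lt1 delta0 r0 a Tx a0 aS Tx0
    (fun i => massS i x) N G G0 (fun i => mass_le i _).
  rewrite etaE -/cc => h.
  apply: (@le_trans _ _ (\sum_(i < N)
     (cc * ((a i * Tx i) `^ r * (G / Tx i) `^ eta) * sigma x)%:E)%E).
    rewrite sumEFin lee_fin -mulr_suml ler_wpM2r// -mulr_sumr.
    apply: le_trans h _; rewrite ler_wpM2l// big_mkcond; apply: ler_sum => i _.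
    by case: ifP => // _; rewrite mulr_ge0 ?powR_ge0.
  have -> : (\sum_(j <oo) S j x = \sum_(i < N) \sum_(j <oo)
      (cc * (z ^+ j.+1)^-1 * (lev j i (c i x) * sigma x))%:E)%E.
    rewrite -nneseries_sum; last first.
      move=> i j _; rewrite lee_fin !mulr_ge0// invr_ge0 exprn_ge0//; exact: ltW.
    by apply: eq_eseriesr => j _; rewrite /S mulr_sumr sumEFin.
  apply: lee_sum => i _.
  have term0 j : (0 <= (cc * (z ^+ j.+1)^-1 * (lev j i (c i x) * sigma x))%:E)%E.
    rewrite lee_fin !mulr_ge0// invr_ge0 exprn_ge0//; exact: ltW.
  have := Tx0 i; rewrite le_eqVlt => /orP[/eqP Ti0|Ti0].
    rewrite -Ti0 mulr0 powR0 ?gt_eqF// mul0r mulr0 mul0r.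
    exact: nneseries_ge0.
  (* only the level [j] of the mass at scale [i] is kept in the series *)
  have [j jP] := geometric_level th0 theta_lt1 Ti0 (mass_le i _).
  apply: le_trans (nneseries_lim_ge j.+1 (fun j _ _ => term0 j)).
  rewrite big_nat_recr//=.
  apply: (@le_trans _ _ (cc * (z ^+ j.+1)^-1 * (lev j i (c i x) * sigma x))%:E); last first.
    by rewrite leeDr// sume_ge0.
  rewrite lee_fin /lev /level_term /in_level jP -!mulrA ler_wpM2l//.
  rewrite [leRHS]mulrCA ler_wpM2l ?powR_ge0// ler_wpM2r//.
  rewrite -zX -(powR_inv1 (powR_ge0 _ _)) powRAC powR_inv1 ?exprn_ge0 ?(ltW th0)//.
  case/andP: jP => jP _.
  rewrite ge0_ler_powR ?(ltW eta0)// ?nnegrE ?divr_ge0 ?invr_ge0 ?exprn_ge0 ?(ltW th0) ?(ltW G0)//.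
  rewrite ler_pdivrMr// mulrC ler_pdivlMr ?exprn_gt0//; exact: ltW.
rewrite integral_nneseries//.
apply: (@le_trans _ _ (\sum_(j <oo)
    ((cc * 2 * K * G `^ rho / z) * z ^+ j)%:E)%E); last first.
  apply: le_trans (nneseries_geometric_le _ (ltW z0) z1) _.
    by rewrite !mulr_ge0 ?powR_ge0// invr_ge0 ltW.
  rewrite lee_fin /levels_const -/eta -/z -/delta -/cc.
  by apply: le_of_eq; field; rewrite !gt_eqF// subr_gt0.
apply: lee_nneseries => [j _ _|j _]; first exact: integral_ge0.
rewrite /S; under eq_integral do rewrite EFinM.
rewrite ge0_integralZl_EFin//; last 2 first.
- by move=> x _; rewrite lee_fin sumr_ge0// => i _; rewrite mulr_ge0.
- by rewrite mulr_ge0// invr_ge0 exprn_ge0// ltW.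
have b0 : 0 <= G * theta ^+ j.+1 by rewrite mulr_ge0 ?exprn_ge0 ?(ltW th0) ?(ltW G0).
have bB : theta * (G * theta ^+ j) <= G * theta ^+ j.+1 by rewrite exprS mulrCA.
have cz0 : 0 <= cc * (z ^+ j.+1)^-1.
  by rewrite mulr_ge0// invr_ge0 exprn_ge0// ltW.
apply: le_trans (lee_wpmul2l _ (level_estimate b0 bB)) _; first by rewrite lee_fin.
rewrite -EFinM lee_fin.
have -> : rho - 1 = eta + eta by rewrite /eta; field.
have GB : 0 < G * theta ^+ j by rewrite mulr_gt0 ?exprn_gt0.
have -> : G `^ rho = G * (G `^ eta * G `^ eta).
  rewrite -powRD ?(gt_eqF G0) ?implybT// -[X in X * _]powRr1 ?(ltW G0)//.
  rewrite -powRD ?(gt_eqF G0) ?implybT//; congr (_ `^ _).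
  by rewrite /eta; field.
rewrite powRD ?(gt_eqF GB) ?implybT// powRM ?exprn_ge0 ?(ltW G0) ?(ltW th0)// zX exprS.
by apply: le_of_eq; field; rewrite !gt_eqF// exprn_gt0.
Qed.

End mass.

(** * The dual estimate for one grid *)

Lemma addzS (k : int) (i : nat) : k + i.+1%:Z = k + i%:Z + 1.
Proof. by lia. Qed.

Lemma powR_regroup (R : realType) (A C m r s : R) : 0 <= A -> 0 <= C ->
  (2 * A * C) `^ r * m `^ (r / s) = (2 * A) `^ r * (C * m `^ s^-1) `^ r.
Proof.
move=> A0 C0; rewrite (mulrC r) (powRrM m) (powRM r _ C0) ?mulr_ge0//.
by rewrite (powRM r C0 (powR_ge0 _ _)) mulrA.
Qed.

Section restricted.
Context {R : realType} {n : nat}.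
Local Notation mu := (@lebesgue_Rn R n).
Variables (alpha p q : R).
Hypotheses (alpha_gt0 : 0 < alpha) (alpha_ltn : alpha < n%:R).
Hypotheses (p_gt1 : 1 < p) (p_ltq : p < q).
Local Notation beta := (n%:R * (p^-1 - q^-1)).
Local Notation p' := (conj_exp p).
Local Notation q' := (conj_exp q).

Let n_gt0 : 0 < n%:R :> R. Proof. exact: lt_trans alpha_ltn. Qed.
Let n_pos : (0 < n)%N. Proof. by rewrite -(ltr0n R). Qed.
Let q_gt1 : 1 < q. Proof. exact: lt_trans p_ltq. Qed.
Let p_gt0 : 0 < p. Proof. exact: lt_trans p_gt1. Qed.
Let q_gt0 : 0 < q. Proof. exact: lt_trans q_gt1. Qed.

Lemma conj_exp_gt1 (s : R) : 1 < s -> 1 < conj_exp s.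
Proof. by move=> s1; rewrite /conj_exp ltr_pdivlMr ?subr_gt0// mul1r; lra. Qed.

Lemma conj_expV (s : R) : 1 < s -> (conj_exp s)^-1 = 1 - s^-1.
Proof.
by move=> s1; rewrite /conj_exp invf_div; field; rewrite gt_eqF//; lra.
Qed.

Lemma conj_expK (s : R) : 1 < s -> conj_exp (conj_exp s) = s.
Proof.
move=> s1; apply: invr_inj; rewrite conj_expV ?conj_exp_gt1// conj_expV//.
by rewrite opprB addrC subrK.
Qed.

Let p'_gt0 : 0 < p'. Proof. by apply: lt_trans (conj_exp_gt1 p_gt1). Qed.
Let q'_gt0 : 0 < q'. Proof. by apply: lt_trans (conj_exp_gt1 q_gt1). Qed.

(** This ratio is the source of the geometric gain: it exceeds [1] because [p < q]. *)
Lemma conj_exp_ratio_gt1 : 1 < p' / q'.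
Proof.
rewrite ltr_pdivlMr// mul1r -ltf_pV2 ?posrE// !conj_expV//.
by rewrite ltrD2l ltrN2 ltf_pV2 ?posrE.
Qed.

(** At least [1/2], so that a cell has at most one heavy child, and large enough that
    [drop_ratio ^+ 2] bounds the decay [2 `^ (alpha - n)] of the coefficients. *)
Definition drop_ratio : R := Num.max (1/2) (2 `^ ((alpha - n%:R) / 2)).

Lemma drop_ratio_half : 1/2 <= drop_ratio.
Proof. by rewrite le_max lexx. Qed.

Lemma drop_ratio_lt1 : drop_ratio < 1.
Proof.
rewrite gt_max; apply/andP; split; first by lra.
pose e := (n%:R - alpha) / 2; have e0 : 0 < e by rewrite /e; move: alpha_ltn; lra.
have -> : (alpha - n%:R) / 2 = - e by rewrite /e; field.
rewrite powRN invf_lt1 ?powR_gt0//.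
have := @gt0_ltr_powR R _ e0 1 2; rewrite !nnegrE powR1; apply => //.
by rewrite ltr1n.
Qed.

Definition side (k0 : int) (i : nat) : R := 2 ^ (k0 + i%:Z).
Definition vol (k0 : int) (i : nat) : R := side k0 i ^+ n.
Definition scale_coef (k0 : int) (i : nat) : R := vol k0 i `^ (alpha / n%:R - 1).

Lemma side_gt0 k0 i : 0 < side k0 i. Proof. exact: two_powz_gt0. Qed.

Lemma sideS k0 i : side k0 i.+1 = 2 * side k0 i.
Proof.
by rewrite /side addzS expfzDr// expr1z mulrC.
Qed.

Lemma vol_gt0 k0 i : 0 < vol k0 i. Proof. by rewrite exprn_gt0// side_gt0. Qed.

Lemma volS k0 i : 2 * vol k0 i <= vol k0 i.+1.
Proof.
rewrite /vol sideS exprMn ler_wpM2r//.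
  by rewrite exprn_ge0// ltW// side_gt0.
by rewrite -[leLHS]expr1 ler_eXn2l// ltr1n.
Qed.

Lemma scale_coefE k0 i : scale_coef k0 i = side k0 i `^ (alpha - n%:R).
Proof.
have s0 := side_gt0 k0 i.
rewrite /scale_coef /vol -powR_mulrn ?(ltW s0)// -powRrM; congr (_ `^ _).
by field; rewrite gt_eqF.
Qed.

Lemma scale_coefS k0 i : scale_coef k0 i.+1 <= drop_ratio ^+ 2 * scale_coef k0 i.
Proof.
have s0 := side_gt0 k0 i.
rewrite !scale_coefE sideS powRM ?(ltW s0)// ler_wpM2r ?powR_ge0//.
have -> : alpha - n%:R = (alpha - n%:R) / 2 + (alpha - n%:R) / 2 by field.
rewrite powRD ?pnatr_eq0 ?implybT// expr2.
by rewrite ler_pM ?powR_ge0// /drop_ratio le_max lexx orbT.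
Qed.

Section estimate.
Variables (t : {ffun 'I_n -> bool}) (k0 : int).
Variables (Psi : R -> R) (u sigma : Rn R n -> R) (E : set (Rn R n)).
Variables (A C G : R).
Local Notation Phi := (associate Psi).
Hypotheses (young : young_function Psi) (wu : weight u) (wsigma : weight sigma).
Hypotheses (mE : measurable E) (A_gt0 : 0 < A) (C_ge0 : 0 <= C).
Hypothesis HA : (two_weight_const alpha q' p' Psi sigma u <= A%:E)%E.
Hypothesis HC : forall f : Rn R n -> R, measurable_fun setT f ->
  ('N[mu]_(q'%:E)[EFin \o f] < +oo ->
   'N[mu]_(p'%:E)[orlicz_maximal beta Phi f] <= C%:E * 'N[mu]_(q'%:E)[EFin \o f])%E.

Definition cut (x : Rn R n) : R := u x * \1_E x.
Hypothesis cutG : (\int[mu]_x (cut x)%:E = G%:E)%E.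

Definition grid_index (i : nat) : Rn R n -> {ffun 'I_n -> int} := gcell t (k0 + i%:Z).
Definition grid_cube (i : nat) m : set (Rn R n) := gcube t (k0 + i%:Z) m.
(** The weight whose Orlicz maximal function controls the chain of the cell [V]. *)
Definition top_weight (k : nat) (V : {ffun 'I_n -> int}) (x : Rn R n) : R :=
  u x `^ q'^-1 * \1_(E `&` grid_index k @^-1` [set V]) x.

(** The value of [(2 A M(top_weight k V))^p'] that comes from the cube of scale [i] and
    index [m]. *)
Definition maximal_term (k : nat) V (i : nat) m : \bar R :=
  (((2 * A) `^ p')%:E *
   (mu (grid_cube i m) `^ (beta / n%:R) * luxemburg Phi (grid_cube i m) (top_weight k V)) `^ p')%E.

Let u0 x : 0 <= u x. Proof. by case: wu. Qed.
Let sigma0 x : 0 <= sigma x. Proof. by case: wsigma. Qed.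
Let mu_ : measurable_fun setT u. Proof. by case: wu. Qed.
Let msigma : measurable_fun setT sigma. Proof. by case: wsigma. Qed.

Lemma measurable_grid_index i m : measurable (grid_index i @^-1` [set m]).
Proof. exact: measurable_gcell. Qed.

Lemma grid_index_nested i x y : grid_index i x = grid_index i y -> grid_index i.+1 x = grid_index i.+1 y.
Proof.
rewrite /grid_index addzS.
exact: gcell_nested.
Qed.

Lemma mu_grid_cell i y : mu (cell grid_index i y) = (vol k0 i)%:E.
Proof. exact: mu_gcell. Qed.

Lemma mu_grid_cube i m : mu (grid_cube i m) = (vol k0 i)%:E.
Proof. exact: mu_gcube. Qed.

Lemma cube_grid_cube i m : cube (grid_cube i m).
Proof. by apply: cube_cube_at; exact: two_powz_gt0. Qed.

Lemma cut_ge0 x : 0 <= cut x.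
Proof. by rewrite mulr_ge0// indicE. Qed.

Lemma measurable_cut : measurable_fun setT cut.
Proof. by apply: measurable_funM => //; exact: measurable_indic. Qed.

Lemma measurable_top_weight k V : measurable_fun setT (top_weight k V).
Proof.
apply: measurable_funM.
  exact: (measurableT_comp (measurable_powR _) mu_).
by apply: measurable_indic; apply: measurableI => //; exact: measurable_grid_index.
Qed.

Lemma top_weight_ge0 k V x : 0 <= top_weight k V x.
Proof. by rewrite mulr_ge0 ?powR_ge0// indicE. Qed.

Lemma maximal_term_ge0 k V i m : (0 <= maximal_term k V i m)%E.
Proof. by rewrite mule_ge0 ?lee_fin ?powR_ge0// poweR_ge0. Qed.

(** [cube_estimate] for the closed cube that contains the cell; on that cell
    [u `^ q^-1 * top_weight] is the restriction of [u] to [E]. *)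
Lemma maximal_term_local k i y : (i <= k)%N ->
  (((scale_coef k0 i * mass mu grid_index cut i (grid_index i y)) `^ p')%:E *
    \int[mu]_(x in cell grid_index i y) (sigma x)%:E <=
  (vol k0 i)%:E * maximal_term k (grid_index k y) i (grid_index i y))%E.
Proof.
move=> ik.
have [s sE] : exists s, (\int[mu]_(x in grid_cube i (grid_index i y)) (sigma x)%:E)%E = s%:E.
  case: wsigma => _ _ /(_ _ (cube_grid_cube i (grid_index i y))) /integrableP[_] int.
  exists (fine (\int[mu]_(x in grid_cube i (grid_index i y)) (sigma x)%:E)%E).
  rewrite fineK// ge0_fin_numE; last by apply: integral_ge0 => x _; rewrite lee_fin.
  apply: le_lt_trans int; apply: le_integral_ge0 => x _; first by rewrite lee_fin.
  exact: lee_abs.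
rewrite /maximal_term [leRHS]muleCA.
have := @cube_estimate R n Psi young (grid_cube i (grid_index i y)) (vol k0 i)
  (measurable_cube (cube_grid_cube _ _)) (vol_gt0 k0 i) (mu_grid_cube _ _)
  (fun x => u x `^ (conj_exp q')^-1) (top_weight k (grid_index k y))
  _ (measurable_top_weight _ _) (fun x => powR_ge0 _ _) (top_weight_ge0 _ _)
  (alpha / n%:R) (p'^-1 - q'^-1) p' A s (mass mu grid_index cut i (grid_index i y)) sigma
  (cell grid_index i y) p'_gt0 A_gt0 (@gcell_sub _ _ _ _ _) sigma0 _ _ sE.
have -> : - (p'^-1 - q'^-1) = beta / n%:R.
  rewrite !conj_expV//; field.
  by rewrite !gt_eqF.
apply.
- exact: (measurableT_comp (measurable_powR _) mu_).
- apply: le_trans HA; apply: ereal_sup_ubound; exists (grid_cube i (grid_index i y)).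
    exact: cube_grid_cube.
  by rewrite addrA.
- rewrite -(massE grid_index (cut_ge0) cutG); apply: eq_integral => x; rewrite inE => xy.
  rewrite /top_weight /cut mulrA -powRD; last first.
    by rewrite conj_expK// conj_expV// addrC subrK oner_eq0.
  rewrite conj_expK// conj_expV// addrC subrK powRr1//; congr (_ * _)%:E.
  have xk : grid_index k x = grid_index k y := cell_nested grid_index_nested ik xy.
  by rewrite !indicE in_setI [x \in grid_index k @^-1` _]mem_set ?andbT.
Qed.

(** The maximal function dominates its value on each single cube, and the
    [q']-th power of [top_weight] is [u] on [E cap V]. *)
Lemma maximal_term_global k y (D : Rn R n -> \bar R) : measurable_fun setT D ->
  (forall x, 0 <= D x)%E ->
  (forall x, exists2 i, (i <= k)%N & (D x <= maximal_term k (grid_index k y) i (grid_index i x))%E) ->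
  (\int[mu]_x D x <=
    ((2 * A * C) `^ p' * mass mu grid_index cut k (grid_index k y) `^ (p' / q'))%:E)%E.
Proof.
move=> mD D0 DW.
set h := top_weight k (grid_index k y).
have q'0 : q' != 0 by rewrite gt_eqF.
have p'0 : p' != 0 by rewrite gt_eqF.
have hN : ('N[mu]_(q'%:E)[EFin \o h] = (mass mu grid_index cut k (grid_index k y) `^ q'^-1)%:E)%E.
  rewrite unlock /= -poweR_EFin; congr (_ `^ _)%E.
  rewrite -(massE grid_index cut_ge0 cutG) [RHS]integral_mkcond.
  apply: eq_integral => x _; rewrite patchE /h /top_weight /cut /=.
  rewrite ger0_norm; last by rewrite mulr_ge0 ?powR_ge0// indicE.
  set e := \1_(_ `&` _) x; have e0 : 0 <= e by rewrite /e indicE.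
  rewrite powRM ?powR_ge0// /e.
  rewrite -powRrM mulVf// powRr1//.
  rewrite !indicE in_setI; case: (x \in E) => /=; last first.
    by rewrite powR0// !mulr0; case: ifP.
  by case: (x \in _); rewrite ?powR1// powR0// mulr0.
have := HC (measurable_top_weight k (grid_index k y)); rewrite -/h hN => /(_ (ltry _)).
move=> /(gt0_ler_poweR (ltW p'_gt0)).
rewrite !in_itv/= !leey !andbT Lnorm_ge0 mule_ge0 ?lee_fin ?powR_ge0// => /(_ isT isT).
rewrite poweR_Lnorm// => hM.
pose c := (2 * A) `^ p'; have c0 : 0 < c by rewrite powR_gt0// mulr_gt0.
(* the constant is moved to [D], which is measurable, before comparing with the
   maximal function *)
have DE : (\int[mu]_x D x = c%:E * \int[mu]_x (c^-1%:E * D x))%E.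
  rewrite ge0_integralZl_EFin ?invr_ge0 ?(ltW c0)//.
  by rewrite muleA -EFinM divff ?gt_eqF// mul1e.
rewrite DE.
have -> : (2 * A * C) `^ p' * mass mu grid_index cut k (grid_index k y) `^ (p' / q') =
    c * (C * mass mu grid_index cut k (grid_index k y) `^ q'^-1) `^ p'.
  by apply: powR_regroup => //; exact: ltW.
rewrite EFinM; apply: lee_wpmul2l; first by rewrite lee_fin ltW.
apply: le_trans hM; apply: le_integral_ge0 => x _.
  by rewrite mule_ge0// lee_fin invr_ge0 ltW.
have [i _] := DW x; rewrite /maximal_term -/c => Dx.
have c1 : (0 <= c^-1%:E)%E by rewrite lee_fin invr_ge0 ltW.
apply: le_trans (lee_wpmul2l c1 Dx) _.
rewrite muleA -EFinM mulVf ?gt_eqF// mul1e.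
apply: gt0_ler_poweR; rewrite ?in_itv/= ?leey ?andbT ?abse_ge0 ?mule_ge0 ?poweR_ge0 ?luxemburg_ge0 ?(ltW p'_gt0)//.
apply: le_trans (lee_abs _); apply: ereal_sup_ubound.
exists (grid_cube i (grid_index i x)) => //; split; first exact: cube_grid_cube.
exact: (@gcell_sub _ _ t (k0 + i%:Z) (grid_index i x) x).
Qed.

Lemma restricted_estimate N : 0 < G ->
  (\int[mu]_x (((\sum_(i < N) scale_coef k0 i * mass mu grid_index cut i (grid_index i x)) `^ p')
      * sigma x)%:E <=
   (levels_const drop_ratio p' (p' / q') * (2 * A * C) `^ p' * G `^ (p' / q'))%:E)%E.
Proof.
move=> G0.
have a0 i : 0 <= scale_coef k0 i by exact: powR_ge0.
refine (mass_estimate measurable_grid_index grid_index_nested measurable_cut cut_ge0 cutG drop_ratio_half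
  drop_ratio_lt1 (vol_gt0 k0) (volS k0) mu_grid_cell N msigma sigma0 a0 (ltW conj_exp_ratio_gt1)
  (powR_ge0 _ _) maximal_term_ge0 maximal_term_local maximal_term_global p'_gt0 conj_exp_ratio_gt1 G0 (scale_coefS k0)).
Qed.

End estimate.
End restricted.

(** * Duality and the Riesz kernel *)

Section abstract_duality.
Local Open Scope ereal_scope.
Context d (T : measurableType d) (R : realType).
Variable mu : {measure set T -> \bar R}.

Lemma cell_integral_symm_le (I : countType) (c : T -> I)
    (mc : forall m, measurable (c @^-1` [set m])) (f g : T -> \bar R) :
  measurable_fun setT f -> (forall x, 0 <= f x) ->
  measurable_fun setT g -> (forall x, 0 <= g x) ->
  \int[mu]_x ((\int[mu]_(y in c @^-1` [set c x]) f y) * g x) <=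
  \int[mu]_x ((\int[mu]_(y in c @^-1` [set c x]) g y) * f x).
Proof.
move=> mf f0 mg g0.
have int0 h m : (forall x, 0 <= h x) -> 0 <= \int[mu]_(y in c @^-1` [set m]) h y.
  by move=> h0; apply: integral_ge0.
have mint h : measurable_fun setT (fun x => \int[mu]_(y in c @^-1` [set c x]) h y).
  exact: (@measurable_fun_cell _ _ _ _ mc _ _
    (fun m => \int[mu]_(y in c @^-1` [set m]) h y)).
apply: (le_integral_cells mc).
- exact: emeasurable_funM.
- by move=> x; rewrite mule_ge0// int0.
- exact: emeasurable_funM.
- by move=> x; rewrite mule_ge0// int0.
move=> z.
have E h k : measurable_fun setT k -> (forall x, 0 <= h x) -> (forall x, 0 <= k x) ->
    \int[mu]_(x in c @^-1` [set c z]) ((\int[mu]_(y in c @^-1` [set c x]) h y) * k x)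
    = (\int[mu]_(y in c @^-1` [set c z]) h y) * \int[mu]_(y in c @^-1` [set c z]) k y.
  move=> mk h0 k0.
  have k0' x : (c @^-1` [set c z]) x -> 0 <= k x by [].
  rewrite -(ge0_integralZl mu (mc (c z)) (measurable_funTS mk) k0' (int0 h (c z) h0)).
  by apply: eq_integral => x; rewrite inE => /= ->.
by rewrite !E// muleC.
Qed.

(** On a cell both sides are the product of the integrals of [f] and [g]. *)
Lemma cell_integral_symm (I : countType) (c : T -> I)
    (mc : forall m, measurable (c @^-1` [set m])) (f g : T -> \bar R) :
  measurable_fun setT f -> (forall x, 0 <= f x) ->
  measurable_fun setT g -> (forall x, 0 <= g x) ->
  \int[mu]_x ((\int[mu]_(y in c @^-1` [set c x]) f y) * g x) =
  \int[mu]_x ((\int[mu]_(y in c @^-1` [set c x]) g y) * f x).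
Proof.
move=> mf f0 mg g0; apply/eqP; rewrite eq_le.
by apply/andP; split; exact: cell_integral_symm_le.
Qed.

(** The weight is distributed as [w = w^(1/p) w^(1/p')]. *)
Lemma weighted_hoelder (p p' : R) (f g w : T -> R) :
  (0 < p)%R -> (0 < p')%R -> (p^-1 + p'^-1 = 1)%R ->
  measurable_fun setT f -> measurable_fun setT g -> measurable_fun setT w ->
  (forall x, 0 <= f x)%R -> (forall x, 0 <= g x)%R -> (forall x, 0 <= w x)%R ->
  \int[mu]_x (f x * g x * w x)%:E <=
  (\int[mu]_x (f x `^ p * w x)%:E) `^ p^-1 *
  (\int[mu]_x (g x `^ p' * w x)%:E) `^ p'^-1.
Proof.
move=> p0 p'0 pp mf mg mw f0 g0 w0.
have mP (s : R) (h : T -> R) : measurable_fun setT h ->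
    measurable_fun setT (fun x => h x `^ s)%R.
  by move=> mh; exact: (measurableT_comp (measurable_powR s) mh).
pose F x := (f x * w x `^ p^-1)%R; pose H x := (g x * w x `^ p'^-1)%R.
have mF : measurable_fun setT F by apply: measurable_funM => //; exact: mP.
have mH : measurable_fun setT H by apply: measurable_funM => //; exact: mP.
have := hoelder mu mF mH p0 p'0 pp.
rewrite Lnorm1 unlock /=.
have F0 x : (0 <= F x)%R by rewrite mulr_ge0 ?powR_ge0.
have H0 x : (0 <= H x)%R by rewrite mulr_ge0 ?powR_ge0.
have pE (s : R) (h : T -> R) : (0 < s)%R -> (forall x, 0 <= h x)%R ->
    \int[mu]_x (`|h x * w x `^ s^-1| `^ s)%:E = \int[mu]_x (h x `^ s * w x)%:E.
  move=> s0 h0; apply: eq_integral => x _.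
  rewrite ger0_norm ?mulr_ge0 ?powR_ge0// powRM ?powR_ge0// -powRrM.
  by rewrite mulVf ?gt_eqF// powRr1.
rewrite (pE p f p0 f0) (pE p' g p'0 g0) => h; apply: le_trans h.
apply: le_integral_ge0 => x _; first by rewrite lee_fin !mulr_ge0.
rewrite lee_fin ger0_norm ?mulr_ge0 ?powR_ge0//.
rewrite /F /H mulrACA -powRD ?pp ?powRr1//.
by rewrite oner_eq0.
Qed.

(** A kernel dominated at each point by one of countably many multiples of indicator
    functions is dominated by their sum. *)
Lemma kernel_series (J : finType) (phi kappa : T -> R) (S : nat -> J -> set T)
    (a : nat -> J -> R) :
  measurable_fun setT phi -> (forall y, 0 <= phi y)%R -> (forall y, 0 <= kappa y)%R ->
  (forall j t, measurable (S j t)) -> (forall j t, 0 <= a j t)%R ->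
  (forall y, kappa y <> 0%R -> exists j t, S j t y /\ (kappa y <= a j t)%R) ->
  \int[mu]_y (phi y * kappa y)%:E <=
  \sum_(j <oo) \sum_(t : J) (a j t)%:E * \int[mu]_(y in S j t) (phi y)%:E.
Proof.
move=> mphi phi0 kappa0 mS a0 ka.
have mphiE D : measurable_fun D (fun y => (phi y)%:E).
  by apply: measurable_funTS; exact/measurable_EFinP.
have phiE0 y : 0 <= (phi y)%:E by rewrite lee_fin.
pose e j t y := (a j t)%:E * ((fun y => (phi y)%:E) \_ (S j t)) y.
have e0 j t y : 0 <= e j t y.
  by rewrite mule_ge0 ?lee_fin//; apply: erestrict_ge0.
have mr j t : measurable_fun setT ((fun y => (phi y)%:E) \_ (S j t)).
  by apply/(measurable_restrictT _ (mS j t)).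
have me j t : measurable_fun setT (e j t) by exact: measurable_funeM.
have se0 j y : 0 <= \sum_(t : J) e j t y by apply: sume_ge0.
apply: (@le_trans _ _ (\int[mu]_y \sum_(j <oo) \sum_(t : J) e j t y)).
  apply: le_integral_ge0 => y _; first by rewrite lee_fin mulr_ge0.
  have [k0|kn0] := eqVneq (kappa y) 0%R.
    by rewrite k0 mulr0; exact: nneseries_ge0.
  have [j [t [Sy kay]]] := ka y (elimN eqP kn0).
  apply: le_trans (nneseries_lim_ge j.+1 (fun j _ _ => se0 j y)).
  rewrite big_nat_recr//=.
  apply: (@le_trans _ _ (\sum_(t : J) e j t y)); last by rewrite leeDr// sume_ge0.
  rewrite (bigD1 t)//=; apply: (@le_trans _ _ (e j t y)); last first.
    by rewrite leeDl// sume_ge0.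
  by rewrite /e patchE mem_set// -EFinM lee_fin mulrC ler_wpM2r.
rewrite integral_nneseries//; last by move=> j; exact: emeasurable_sum.
apply: lee_nneseries => [j _ _|j _]; first exact: integral_ge0.
rewrite ge0_integral_sum//; apply: lee_sum => t _.
rewrite /e ge0_integralZl_EFin//; last by move=> x _; apply: erestrict_ge0.
by rewrite [in leRHS]integral_mkcond.
Qed.

End abstract_duality.

Section scales.
Context {R : realType}.

Lemma dyadic_scale (z : R) : 0 < z -> exists k : int, (2 ^ k / 2 <= z < 2 ^ k).
Proof.
move=> z0.
have two0 : 0 < (2 : R) by [].
have l2 : 0 < ln (2 : R) by rewrite ln_gt0// ltr1n.
have pw (k : int) : (2 : R) ^ k = expR (k%:~R * ln 2).
  by rewrite -powR_intmul// /powR gt_eqF.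
exists (Num.floor (ln z / ln 2) + 1).
have /andP[f1 f2] := floor_itv (ln z / ln 2).
apply/andP; split.
  rewrite expfzDr// expr1z mulfK// pw -[leRHS]lnK ?posrE// ler_expR.
  by rewrite -ler_pdivlMr.
by rewrite pw -[ltLHS]lnK ?posrE// ltr_expR -ltr_pdivrMr// intrD1.
Qed.

(** The left-hand side is visibly monotone in [m], the right-hand side is a sum over
    consecutive scales. *)
Lemma sum_symmetric_range (F : int -> \bar R) m :
  (\sum_(j < m) (F j%:Z + F (- j.+1%:Z)%R) =
  \sum_(i < m.*2) F (- m%:Z + i%:Z)%R)%E.
Proof.
elim: m => [|m IH]; first by rewrite !big_ord0.
rewrite big_ord_recr/= IH doubleS big_ord_recr big_ord_recl/=.
have -> : (- m.+1%:Z + m.*2.+1%:Z)%R = m%:Z by lia.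
have -> : (- m.+1%:Z + 0%:Z)%R = (- m.+1%:Z)%R by lia.
have -> : \sum_(i < m.*2) F (- m.+1%:Z + bump 0 i) = \sum_(i < m.*2) F (- m%:Z + i%:Z).
  by apply: eq_bigr => i _; congr F; rewrite /bump /=; lia.
have comm (x y z : \bar R) : (x + (y + z) = z + x + y)%E by rewrite addeA addeC addeA.
exact: comm.
Qed.
End scales.

Section kernel.
Context {R : realType} {n : nat}.
Local Notation mu := (@lebesgue_Rn R n).
Variable alpha : R.
Hypothesis alpha_ltn : alpha < n%:R.
Implicit Types (x y : Rn R n) (phi : Rn R n -> R).

Lemma coord_le_dist x y (i : 'I_n) : `|tnth x i - tnth y i| <= euclid_dist x y.
Proof.
rewrite -sqrtr_sqr ler_wsqrtr// (bigD1 i)//= lerDl.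
by apply: sumr_ge0 => j _; exact: sqr_ge0.
Qed.

(** The scale is that of three times the distance: the coordinates are then close enough
    for [gcell_third]. *)
Lemma kernel_le x y : 0 < euclid_dist x y -> exists k t,
  gcell t k x = gcell t k y /\
  (euclid_dist x y `^ (n%:R - alpha))^-1 <=
    6 `^ (n%:R - alpha) * (2 ^ k) `^ (alpha - n%:R).
Proof.
set D := euclid_dist x y => D0.
have [k /andP[k1 k2]] := @dyadic_scale R (3 * D) (mulr_gt0 (ltr0Sn _ _) D0).
have [t xy] : exists t, gcell t k x = gcell t k y.
  apply: gcell_third => i; apply: le_lt_trans (coord_le_dist x y i) _.
  by rewrite -/D; lra.
exists k, t; split => //.
have s0 : 0 < (2 : R) ^ k by exact: two_powz_gt0.
have e0 : 0 <= n%:R - alpha by rewrite subr_ge0 ltW.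
rewrite -(opprB n%:R alpha) powRN ler_pdivlMr ?powR_gt0// mulrC ler_pdivrMr ?powR_gt0//.
rewrite -powRM ?(ltW D0)// ge0_ler_powR// ?nnegrE ?mulr_ge0 ?(ltW s0) ?(ltW D0)//.
by move: k1; lra.
Qed.

Definition scale_term phi x (t : {ffun 'I_n -> bool}) (k : int) : \bar R :=
  (((2 ^ k) `^ (alpha - n%:R))%:E *
   \int[mu]_(y in gcell t k @^-1` [set gcell t k x]) (phi y)%:E)%E.

(** The contribution of the scales [- m <= k < m] of all the grids. *)
Definition truncated phi m x : \bar R :=
  (\sum_(j < m) \sum_(t : {ffun 'I_n -> bool})
    (scale_term phi x t j%:Z + scale_term phi x t (- j.+1%:Z)%R))%E.

Lemma scale_term_ge0 phi x t k : (forall y, 0 <= phi y) ->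
  (0 <= scale_term phi x t k)%E.
Proof.
move=> phi0; rewrite mule_ge0 ?lee_fin ?powR_ge0//.
by apply: integral_ge0 => y _; rewrite lee_fin.
Qed.

Lemma truncatedE phi m x : truncated phi m x =
  (\sum_(t : {ffun 'I_n -> bool}) \sum_(i < m.*2)
    scale_term phi x t (- m%:Z + i%:Z)%R)%E.
Proof.
rewrite /truncated exchange_big/=; apply: eq_bigr => t _.
by rewrite -sum_symmetric_range.
Qed.

Lemma truncated_homo phi x m m' : (forall y, 0 <= phi y) -> (m <= m')%N ->
  (truncated phi m x <= truncated phi m' x)%E.
Proof.
move=> phi0 /subnK <-; elim: (m' - m)%N => [//|k IH].
rewrite addSn; apply: (le_trans IH); rewrite /truncated big_ord_recr/= leeDl//.
by apply: sume_ge0 => t _; rewrite adde_ge0 ?scale_term_ge0.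
Qed.

Lemma riesz_ge0 phi x : (forall y, 0 <= phi y) -> (0 <= riesz_potential alpha phi x)%E.
Proof.
by move=> phi0; apply: integral_ge0 => y _; rewrite lee_fin divr_ge0// powR_ge0.
Qed.

(** Otherwise the series over all scales, which dominates the potential by
    [kernel_le] and [kernel_series], would be at most [s]. *)
Lemma riesz_le_truncated phi x (s : R) :
  measurable_fun setT phi -> (forall y, 0 <= phi y) ->
  (s%:E < riesz_potential alpha phi x)%E ->
  exists m, (s%:E < (6 `^ (n%:R - alpha))%:E * truncated phi m x)%E.
Proof.
move=> mphi phi0 sI; apply/not_existsP => none.
move: sI; apply/negP; rewrite -leNgt.
pose c0 : R := 6 `^ (n%:R - alpha).
pose J := ({ffun 'I_n -> bool} * bool)%type.
(* scales are enumerated as [0, -1, 1, -2, ..], two for each natural number *)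
pose kk j (b : bool) : int := if b then - j.+1%:Z else j%:Z.
pose S j (t : J) : set (Rn R n) := gcell t.1 (kk j t.2) @^-1` [set gcell t.1 (kk j t.2) x].
pose a j (t : J) : R := c0 * (2 ^ kk j t.2) `^ (alpha - n%:R).
have mS j t : measurable (S j t) by exact: measurable_gcell.
have a0 j t : 0 <= a j t by rewrite mulr_ge0 ?powR_ge0.
pose kap y := (euclid_dist x y `^ (n%:R - alpha))^-1.
have kap0 y : 0 <= kap y by rewrite invr_ge0 powR_ge0.
have kapP y : kap y <> 0 -> exists j t, S j t y /\ kap y <= a j t.
  move=> k0; have D0 : 0 < euclid_dist x y.
    rewrite lt_neqAle sqrtr_ge0 andbT eq_sym; apply/eqP => D0; apply: k0.
    by rewrite /kap D0 powR0 ?invr0// subr_eq0 gt_eqF.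
  have [k [t [xy le]]] := kernel_le D0.
  case: k xy le => [j|j] xy le.
    by exists j, (t, false); rewrite /S /a /=.
  by exists j, (t, true); rewrite /S /a /= -NegzE.
apply: le_trans (kernel_series mu mphi phi0 kap0 mS a0 kapP) _.
apply: lime_le.
  apply: is_cvg_nneseries => j _ _; apply: sume_ge0 => t _.
  by rewrite mule_ge0 ?lee_fin//; apply: integral_ge0 => y _; rewrite lee_fin.
apply: nearW => m; have := none m; move/negP; rewrite -leNgt; apply: le_trans.
rewrite big_mkord /truncated ge0_sume_distrr; last first.
  by move=> j _; apply: sume_ge0 => t _; rewrite adde_ge0 ?scale_term_ge0.
apply: lee_sum => j _.
rewrite ge0_sume_distrr; last first.
  by move=> t _; rewrite adde_ge0 ?scale_term_ge0.
have -> : (\sum_(t : J) (a j t)%:E * \int[mu]_(y in S j t) (phi y)%:E =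
    \sum_(t : {ffun 'I_n -> bool}) \sum_(b : bool)
     c0%:E * scale_term phi x t (kk j b))%E.
  rewrite pair_big/=; apply: eq_bigr => -[t b] _.
  by rewrite /scale_term muleA -EFinM.
apply: lee_sum => t _; rewrite big_bool/= ge0_muleDr ?scale_term_ge0//.
by rewrite addeC.
Qed.

Lemma measurable_truncated phi m : measurable_fun setT (truncated phi m).
Proof.
have ms t k : measurable_fun setT (fun x => scale_term phi x t k).
  exact: (@measurable_fun_cell _ _ _ _ (measurable_gcell t k) _ _
    (fun c => ((2 ^ k) `^ (alpha - n%:R))%:E *
      \int[mu]_(y in gcell t k @^-1` [set c]) (phi y)%:E)%E).
apply: emeasurable_sum => j; apply: emeasurable_sum => t.
exact: emeasurable_funD.
Qed.

End kernel.

(** * The weak type inequality *)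

Section truncated_duality.
Context d (T : measurableType d) (R : realType).
Variable mu : {measure set T -> \bar R}.
Variables (I : countType) (c : nat -> T -> I).
Hypothesis mc : forall i m, measurable (c i @^-1` [set m]).
Local Open Scope ereal_scope.

Lemma truncated_duality (g phi : T -> R) (G : R) (a : nat -> R) N :
  measurable_fun setT g -> (forall x, 0 <= g x)%R ->
  measurable_fun setT phi -> (forall x, 0 <= phi x)%R -> (forall i, 0 <= a i)%R ->
  \int[mu]_x (g x)%:E = G%:E ->
  \int[mu]_x ((\sum_(i < N) (a i)%:E *
      \int[mu]_(y in c i @^-1` [set c i x]) (phi y)%:E) * (g x)%:E) =
  \int[mu]_x ((\sum_(i < N) a i * mass mu c g i (c i x)) * phi x)%:E.
Proof.
move=> mg g0 mphi phi0 a0 gG.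
have gE0 x : 0 <= (g x)%:E by rewrite lee_fin.
have pE0 x : 0 <= (phi x)%:E by rewrite lee_fin.
have mgE : measurable_fun setT (fun x => (g x)%:E) by exact/measurable_EFinP.
have mpE : measurable_fun setT (fun x => (phi x)%:E) by exact/measurable_EFinP.
have aE0 i : 0 <= (a i)%:E by rewrite lee_fin.
have int0 (h : T -> R) (D : set T) : (forall x, 0 <= (h x)%:E) ->
    0 <= \int[mu]_(y in D) (h y)%:E by move=> h0; apply: integral_ge0.
have mint (h : T -> R) i :
    measurable_fun setT (fun x => \int[mu]_(y in c i @^-1` [set c i x]) (h y)%:E).
  exact: (@measurable_fun_cell _ _ _ _ (mc i) _ _
    (fun m => \int[mu]_(y in c i @^-1` [set m]) (h y)%:E)).
pose X (h k : T -> R) i x := (a i)%:E *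
  ((\int[mu]_(y in c i @^-1` [set c i x]) (h y)%:E) * (k x)%:E).
have X0 h k i x : (forall x, 0 <= (h x)%:E) -> (forall x, 0 <= (k x)%:E) -> 0 <= X h k i x.
  by move=> h0 k0; rewrite mule_ge0// mule_ge0// int0.
have mX h k i : measurable_fun setT (fun x => (k x)%:E) -> measurable_fun setT (X h k i).
  by move=> mk; apply: measurable_funeM; exact: emeasurable_funM.
transitivity (\int[mu]_x \sum_(i < N) X phi g i x).
  apply: eq_integral => x _; rewrite ge0_sume_distrl; last first.
    by move=> i _; rewrite mule_ge0// int0.
  by apply: eq_bigr => i _; rewrite -muleA.
transitivity (\int[mu]_x \sum_(i < N) X g phi i x); last first.
  apply: eq_integral => x _; rewrite mulr_suml -sumEFin; apply: eq_bigr => i _.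
  by rewrite /X (massE c g0 gG) -!EFinM mulrA.
rewrite !ge0_integral_sum//; [|by move=> *; exact: mX|by move=> *; exact: X0
  |by move=> *; exact: mX|by move=> *; exact: X0].
apply: eq_bigr => i _; rewrite /X.
have mul0 (h k : T -> R) x : (forall x, 0 <= (h x)%:E) -> (forall x, 0 <= (k x)%:E) ->
   0 <= (\int[mu]_(y in c i @^-1` [set c i x]) (h y)%:E) * (k x)%:E.
  by move=> h0 k0; rewrite mule_ge0// int0.
rewrite (ge0_integralZl_EFin mu measurableT (fun x _ => mul0 _ _ x pE0 gE0) _ (a0 i)); last first.
  exact: emeasurable_funM.
rewrite (ge0_integralZl_EFin mu measurableT (fun x _ => mul0 _ _ x gE0 pE0) _ (a0 i)); last first.
  exact: emeasurable_funM.
by rewrite (cell_integral_symm mu (mc i) mpE pE0 mgE gE0).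
Qed.

End truncated_duality.

(** Chebyshev's inequality against the measure [g], for a finite sum. *)
Lemma chebyshev_sum d (T : measurableType d) (R : realType)
    (mu : {measure set T -> \bar R}) (J : finType) (H : J -> T -> \bar R)
    (g : T -> R) (G s k : R) :
  (forall t, measurable_fun setT (H t)) -> (forall t x, 0 <= H t x)%E ->
  measurable_fun setT g -> (forall x, 0 <= g x) -> 0 <= s -> 0 <= k ->
  (\int[mu]_x (g x)%:E = G%:E)%E ->
  (forall x, g x <> 0%R -> s%:E <= k%:E * \sum_(t : J) H t x)%E ->
  (s%:E * G%:E <= k%:E * \sum_(t : J) \int[mu]_x (H t x * (g x)%:E))%E.
Proof.
move=> mH H0 mg g0 s0 k0 gG sH.
have mgE : measurable_fun setT (fun x => (g x)%:E) by exact/measurable_EFinP.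
have gE0 x : (0 <= (g x)%:E)%E by rewrite lee_fin.
rewrite -gG -ge0_integralZl_EFin// -ge0_integral_sum//; last 2 first.
- by move=> t; exact: emeasurable_funM.
- by move=> t x _; rewrite mule_ge0.
rewrite -ge0_integralZl_EFin//; last 2 first.
- by move=> x _; apply: sume_ge0 => t _; rewrite mule_ge0.
- by apply: emeasurable_sum => t; exact: emeasurable_funM.
apply: le_integral_ge0 => x _; first by rewrite mule_ge0.
rewrite -ge0_sume_distrl// muleA.
have [->|/eqP gx] := eqVneq (g x) 0; first by rewrite !mule0.
by rewrite lee_wpmul2r// sH.
Qed.

Section big_cubes.
Context {R : realType} {n : nat}.
Local Notation mu := (@lebesgue_Rn R n).

Definition big_cube (m : nat) : set (Rn R n) :=
  cube_at [tuple (- m.+1%:R : measurableTypeR R) | _ < n] (2 * m.+1%:R).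

Lemma big_cubeP m (x : Rn R n) :
  big_cube m x <-> forall i, `|tnth x i| <= m.+1%:R :> R.
Proof.
have e : (- m.+1%:R + 2 * m.+1%:R : R) = m.+1%:R by ring.
by split=> h i; have := h i; rewrite tnth_mktuple ler_norml e.
Qed.

Lemma cube_big_cube m : cube (big_cube m).
Proof. by apply: cube_cube_at; rewrite mulr_gt0. Qed.

Lemma measurable_big_cube m : measurable (big_cube m).
Proof. exact: measurable_cube_at. Qed.

Lemma big_cube_homo m m' : (m <= m')%N -> big_cube m `<=` big_cube m'.
Proof.
move=> mm' x /big_cubeP h; apply/big_cubeP => i; apply: le_trans (h i) _.
by rewrite ler_nat.
Qed.

Lemma big_cube_cover (x : Rn R n) : exists m, big_cube m x.
Proof.
exists (Num.truncn (\sum_(i < n) `|tnth x i : R|)); apply/big_cubeP => i.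
apply/ltW; apply: le_lt_trans (truncnS_gt _).
by rewrite (bigD1 i)//= lerDl sumr_ge0.
Qed.

Lemma weight_big_cube_lty m (w : Rn R n -> R) : weight w ->
  (\int[mu]_(x in big_cube m) (w x)%:E < +oo)%E.
Proof.
move=> [_ w0 /(_ _ (cube_big_cube m)) /integrableP[_]]; apply: le_lt_trans.
apply: le_integral_ge0 => x _; first by rewrite lee_fin.
exact: lee_abs.
Qed.

Lemma integral_cut (u : Rn R n -> R) E :
  (\int[mu]_x (cut u E x)%:E = \int[mu]_(x in E) (u x)%:E)%E.
Proof.
rewrite [RHS]integral_mkcond; apply: eq_integral => x _.
by rewrite patchE /cut indicE; case: (x \in E); rewrite ?mulr1 ?mulr0.
Qed.

End big_cubes.

Section weak_type.
Context {R : realType} {n : nat}.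
Local Notation mu := (@lebesgue_Rn R n).
Variables (alpha p q : R).
Hypotheses (alpha_gt0 : 0 < alpha) (alpha_ltn : alpha < n%:R).
Hypotheses (p_gt1 : 1 < p) (p_ltq : p < q).
Local Notation beta := (n%:R * (p^-1 - q^-1)).
Local Notation p' := (conj_exp p).
Local Notation q' := (conj_exp q).

Let p_gt0 : 0 < p. Proof. exact: lt_trans p_gt1. Qed.
Let q_gt1 : 1 < q. Proof. exact: lt_trans p_ltq. Qed.
Let q_gt0 : 0 < q. Proof. exact: lt_trans q_gt1. Qed.
Let p'_gt0 : 0 < p'. Proof. by apply: lt_trans (conj_exp_gt1 p_gt1). Qed.
Let q'_gt0 : 0 < q'. Proof. by apply: lt_trans (conj_exp_gt1 q_gt1). Qed.

Definition weak_const : R :=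
  6 `^ (n%:R - alpha) * #|{ffun 'I_n -> bool}|%:R *
  levels_const (drop_ratio (n := n) alpha) p' (p' / q') `^ p'^-1 * 2.

Variables (Psi : R -> R) (u sigma f : Rn R n -> R) (A C : R).
Local Notation Phi := (associate Psi).
Hypotheses (young : young_function Psi) (wu : weight u) (wsigma : weight sigma).
Hypotheses (A_gt0 : 0 < A) (C_ge0 : 0 <= C).
Hypothesis HA : (two_weight_const alpha q' p' Psi sigma u <= A%:E)%E.
Hypothesis HC : forall h : Rn R n -> R, measurable_fun setT h ->
  ('N[mu]_(q'%:E)[EFin \o h] < +oo ->
   'N[mu]_(p'%:E)[orlicz_maximal beta Phi h] <= C%:E * 'N[mu]_(q'%:E)[EFin \o h])%E.
Hypotheses (mf : measurable_fun setT f) (f0 : forall x, 0 <= f x).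
Variable F : R.
Hypothesis fF : (Lp_norm p sigma f = F%:E)%E.

Let u0 x : 0 <= u x. Proof. by case: wu. Qed.
Let sigma0 x : 0 <= sigma x. Proof. by case: wsigma. Qed.
Let mu_ : measurable_fun setT u. Proof. by case: wu. Qed.
Let msigma : measurable_fun setT sigma. Proof. by case: wsigma. Qed.
Let phi (x : Rn R n) : R := f x * sigma x.
Let mphi : measurable_fun setT phi. Proof. exact: measurable_funM. Qed.
Let phi0 x : 0 <= phi x. Proof. exact: mulr_ge0. Qed.

Let Lpos : 0 <= levels_const (drop_ratio (n := n) alpha) p' (p' / q').
Proof.
have th0 : 0 < drop_ratio (n := n) alpha by apply: lt_le_trans (drop_ratio_half _); lra.
have th1 : drop_ratio (n := n) alpha < 1 := drop_ratio_lt1 alpha_ltn.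
have r1 : 0 < (p' / q' - 1) / 2.
  by rewrite divr_gt0// subr_gt0 conj_exp_ratio_gt1.
rewrite /levels_const; apply: mulr_ge0; first exact: powR_ge0.
rewrite !divr_ge0 ?powR_ge0// subr_ge0 ltW//; exact: theta_powR_lt1.
Qed.

(** Duality and the dual estimate for one grid: the left-hand side is the integral of
    [f sigma] against the dyadic operator of [u 1_E]. *)
Lemma grid_dual_estimate t m (E : set (Rn R n)) (G : R) : measurable E -> 0 < G ->
  (\int[mu]_x (cut u E x)%:E = G%:E)%E ->
  (\int[mu]_x ((\sum_(i < m.*2) scale_term alpha phi x t (- m%:Z + i%:Z)%R) *
     (cut u E x)%:E) <=
   (F * (levels_const (drop_ratio (n := n) alpha) p' (p' / q') `^ p'^-1 *
    (2 * A * C) * G `^ q'^-1))%:E)%E.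
Proof.
move=> mE G0 cG.
have a0 i : 0 <= scale_coef (n := n) alpha (- m%:Z) i by exact: powR_ge0.
have mcut := measurable_cut wu mE.
have cut0 := cut_ge0 E wu.
have := @truncated_duality _ _ _ mu _ (grid_index t (- m%:Z)) (measurable_grid_index t (- m%:Z)) (cut u E) phi G
  (scale_coef (n := n) alpha (- m%:Z)) m.*2 mcut cut0 mphi phi0 a0 cG.
have -> : (\int[mu]_x ((\sum_(i < m.*2) (scale_coef (n := n) alpha (- m%:Z) i)%:E *
      \int[mu]_(y in grid_index t (- m%:Z) i @^-1` [set grid_index t (- m%:Z) i x]) (phi y)%:E)
      * (cut u E x)%:E) =
    \int[mu]_x ((\sum_(i < m.*2) scale_term alpha phi x t (- m%:Z + i%:Z)%R) *
     (cut u E x)%:E))%E.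
  apply: eq_integral => x _; congr (_ * _)%E; apply: eq_bigr => i _.
  by rewrite (scale_coefE alpha_gt0 alpha_ltn).
move=> ->.
pose S (x : Rn R n) : R := \sum_(i < m.*2) scale_coef (n := n) alpha (- m%:Z) i *
  mass mu (grid_index t (- m%:Z)) (cut u E) i (grid_index t (- m%:Z) i x).
have S0 x : 0 <= S x.
  by apply: sumr_ge0 => i _; rewrite mulr_ge0// (mass_ge0 _ cut0 cG).
have mS : measurable_fun setT S.
  apply: measurable_sum => i.
  exact: (@measurable_fun_cell _ _ _ _ (measurable_grid_index t (- m%:Z) i) _ _
    (fun c => scale_coef (n := n) alpha (- m%:Z) i * mass mu (grid_index t (- m%:Z)) (cut u E) i c)).
have pp : p^-1 + p'^-1 = 1 by rewrite conj_expV// addrC subrK.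
have := @weighted_hoelder _ _ _ mu p p' f S sigma p_gt0 p'_gt0 pp mf mS msigma f0 S0 sigma0.
have -> : (\int[mu]_x (f x * S x * sigma x)%:E = \int[mu]_x (S x * phi x)%:E)%E.
  by apply: eq_integral => x _; rewrite /phi mulrCA mulrA.
move=> /le_trans; apply.
have <- : (Lp_norm p sigma f = (\int[mu]_x (f x `^ p * sigma x)%:E) `^ p^-1)%E.
  by congr (_ `^ _)%E; apply: eq_integral => x _; rewrite (ger0_norm (f0 x)).
rewrite fF EFinM; apply: lee_wpmul2l; first by rewrite -fF poweR_ge0.
have Sint0 : (0 <= \int[mu]_x (S x `^ p' * sigma x)%:E)%E.
  by apply: integral_ge0 => x _; rewrite lee_fin mulr_ge0 ?powR_ge0.
have := restricted_estimate alpha_gt0 alpha_ltn p_gt1 p_ltq t (- m%:Z)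
  young wu wsigma mE A_gt0 C_ge0 HA HC cG m.*2 G0.
move=> /(@gt0_ler_poweR _ p'^-1); rewrite invr_ge0 (ltW p'_gt0) => /(_ isT).
rewrite !in_itv/= !leey !andbT => /(_ Sint0).
rewrite lee_fin (mulr_ge0 (mulr_ge0 Lpos (powR_ge0 _ _)) (powR_ge0 _ _)).
move=> /(_ isT) /le_trans; apply.
rewrite lee_fin (powRM _ (mulr_ge0 Lpos (powR_ge0 _ _)) (powR_ge0 _ _)).
rewrite (powRM _ Lpos (powR_ge0 _ _)) -!powRrM mulfV ?gt_eqF//.
rewrite powRr1 ?mulr_ge0 ?(ltW A_gt0)//.
have -> // : p' / q' / p' = q'^-1 by rewrite mulrAC mulfV ?mul1r// gt_eqF.
Qed.

(** The weak type estimate on a set of finite mass; [G = u(E)] splits as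
    [G^(1/q) G^(1/q')] and the second factor is cancelled. *)
Lemma weak_core m (E : set (Rn R n)) (G s : R) : measurable E -> 0 < s -> 0 <= G ->
  (\int[mu]_x (cut u E x)%:E = G%:E)%E ->
  (forall x, E x -> s%:E < (6 `^ (n%:R - alpha))%:E * truncated alpha phi m x)%E ->
  s * G `^ q^-1 <= weak_const * A * C * F.
Proof.
move=> mE s0; rewrite le_eqVlt => /orP[/eqP<-|G0] cG Es.
  rewrite powR0 ?invr_eq0 ?gt_eqF// mulr0 /weak_const.
  by rewrite !mulr_ge0 ?powR_ge0 ?(ltW A_gt0)// -lee_fin -fF poweR_ge0.
have mcut := measurable_cut wu mE.
have cut0 := cut_ge0 E wu.
have mcE : measurable_fun setT (fun x => (cut u E x)%:E) by exact/measurable_EFinP.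
have cE0 x : (0 <= (cut u E x)%:E)%E by rewrite lee_fin.
pose c0 : R := 6 `^ (n%:R - alpha); have c00 : 0 <= c0 by exact: powR_ge0.
pose H t x := (\sum_(i < m.*2) scale_term alpha phi x t (- m%:Z + i%:Z)%R)%E.
have H0 t x : (0 <= H t x)%E by apply: sume_ge0 => i _; exact: scale_term_ge0.
have mH t : measurable_fun setT (H t).
  apply: emeasurable_sum => i; rewrite /scale_term.
  exact: (@measurable_fun_cell _ _ _ _ (measurable_gcell t (- m%:Z + i%:Z)) _ _
    (fun c => ((2 ^ (- m%:Z + i%:Z)) `^ (alpha - n%:R))%:E *
      \int[mu]_(y in gcell t (- m%:Z + i%:Z) @^-1` [set c]) (phi y)%:E)%E).
have step : (s%:E * G%:E <= c0%:E * \sum_(t : {ffun 'I_n -> bool})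
    \int[mu]_x (H t x * (cut u E x)%:E))%E.
  apply: (chebyshev_sum mH H0 mcut cut0 (ltW s0) c00 cG) => x cx.
  have Ex : E x.
    by apply: contrapT => Ex; apply: cx; rewrite /cut indicE memNset// mulr0.
  by rewrite -truncatedE; apply/ltW/Es.
have : (s%:E * G%:E <= c0%:E * \sum_(t : {ffun 'I_n -> bool})
    (F * (levels_const (drop_ratio (n := n) alpha) p' (p' / q') `^ p'^-1 *
    (2 * A * C) * G `^ q'^-1))%:E)%E.
  apply: (le_trans step); apply: lee_wpmul2l; first by rewrite lee_fin.
  by apply: lee_sum => t _; exact: grid_dual_estimate.
rewrite sumEFin -!EFinM lee_fin sumr_const -[X in _ <= _ * X]mulr_natl => h.
have GE : s * G = s * G `^ q^-1 * G `^ q'^-1.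
  rewrite -mulrA -powRD; last by rewrite (gt_eqF G0) implybT.
  by rewrite conj_expV// addrC subrK powRr1// ltW.
have Gq : 0 < G `^ q'^-1 by exact: powR_gt0.
move: h; rewrite GE -ler_pdivlMr// => /le_trans; apply.
rewrite -/c0 /weak_const -/c0; apply: le_of_eq; field.
by rewrite gt_eqF.
Qed.

Lemma weak_const_ge0 : 0 <= weak_const.
Proof. by rewrite !mulr_ge0 ?powR_ge0. Qed.

(** The level set is exhausted by its intersections with large cubes on which a truncation
    already exceeds the level; these have finite mass. *)
Lemma weak_estimate :
  (weak_Lq_norm q u (riesz_potential alpha phi) <= (weak_const * A * C * F)%:E)%E.
Proof.
have F0 : 0 <= F by rewrite -lee_fin -fF poweR_ge0.
set B := weak_const * A * C * F.
have B0 : 0 <= B.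
  exact: mulr_ge0 (mulr_ge0 (mulr_ge0 weak_const_ge0 (ltW A_gt0)) C_ge0) F0.
apply: ge_ereal_sup => _ [s /= s0 <-].
pose Em m : set (Rn R n) := big_cube m `&`
  [set x | s%:E < (6 `^ (n%:R - alpha))%:E * truncated alpha phi m x]%E.
have mEm m : measurable (Em m).
  apply: measurableI; first exact: measurable_big_cube.
  rewrite -[X in measurable X]setTI.
  apply: (emeasurable_fun_o_infty measurableT).
  by apply: measurable_funeM; exact: measurable_truncated.
have ndEm : nondecreasing_seq Em.
  move=> m m' mm'; apply/subsetPset => x [xm sx]; split.
    exact: (big_cube_homo mm').
  apply: lt_le_trans sx _; apply: lee_wpmul2l; first by rewrite lee_fin powR_ge0.
  exact: truncated_homo.
have sub : [set x | (s%:E < `|riesz_potential alpha phi x|)%E] `<=` \bigcup_m Em m.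
  move=> x /=; rewrite gee0_abs; last exact: riesz_ge0.
  move=> /(riesz_le_truncated alpha_ltn mphi phi0)[m1 sm1].
  have [m2 xm2] := big_cube_cover x.
  exists (maxn m1 m2) => //; split; first exact: (big_cube_homo (leq_maxr _ _)) xm2.
  apply: lt_le_trans sm1 _; apply: lee_wpmul2l; first by rewrite lee_fin powR_ge0.
  by apply: truncated_homo => //; exact: leq_maxl.
have bound m : (\int[mu]_(x in Em m) (u x)%:E <= ((B / s) `^ q)%:E)%E.
  have [G cG] : exists G, (\int[mu]_x (cut u (Em m) x)%:E = G%:E)%E.
    exists (fine (\int[mu]_x (cut u (Em m) x)%:E)%E); rewrite fineK//.
    rewrite ge0_fin_numE; last by apply: integral_ge0 => x _; rewrite lee_fin cut_ge0.
    rewrite integral_cut.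
    apply: le_lt_trans (weight_big_cube_lty m wu).
    by apply: le_integral_setS => [x []//|x _]; rewrite lee_fin.
  have G0 : 0 <= G.
    by rewrite -lee_fin -cG integral_ge0// => x _; rewrite lee_fin cut_ge0.
  have := weak_core (mEm m) s0 G0 cG (fun x Ex => Ex.2).
  rewrite -integral_cut cG lee_fin -/B => h.
  rewrite -[leLHS]powRr1// -(mulVf (lt0r_neq0 q_gt0)) powRrM.
  by rewrite ge0_ler_powR ?(ltW q_gt0)// ?nnegrE ?powR_ge0 ?divr_ge0 ?(ltW s0)//
     ler_pdivlMr// mulrC.
have lim : (\int[mu]_(x in \bigcup_m Em m) (u x)%:E <= ((B / s) `^ q)%:E)%E.
  have cv := @ge0_nondecreasing_set_cvg_integral _ _ _ Em (fun x => (u x)%:E) mu ndEm mEm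
    (fun m => measurable_funTS ((measurable_EFinP _ _).2 mu_))
    (fun m x _ => u0 x).
  rewrite -(cvg_lim _ cv)//; apply: lime_le; first by apply/cvg_ex; eexists; exact: cv.
  by apply: nearW.
have X0 : (0 <= \int[mu]_(x in [set x | (s%:E < `|riesz_potential alpha phi x|)%E])
    (u x)%:E)%E by apply: integral_ge0 => x _; rewrite lee_fin.
have X1 : (\int[mu]_(x in [set x | (s%:E < `|riesz_potential alpha phi x|)%E])
    (u x)%:E <= ((B / s) `^ q)%:E)%E.
  apply: le_trans lim; apply: le_integral_setS sub _ => x _; by rewrite lee_fin.
have q1 : 0 <= q^-1 by rewrite invr_ge0 ltW.
move: X1 => /(@gt0_ler_poweR _ q^-1 q1).
rewrite !in_itv/= !leey !andbT X0 lee_fin powR_ge0 => /(_ isT isT).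
rewrite -powRrM mulfV ?gt_eqF// powRr1 ?divr_ge0 ?(ltW s0)// => h.
apply: le_trans (lee_wpmul2l _ h) _; first by rewrite lee_fin ltW.
by rewrite -EFinM lee_fin mulrC divfK// gt_eqF.
Qed.

End weak_type.

(** * The degenerate case *)

(** A nonnegative function of zero integral vanishes almost everywhere. *)
Lemma integral_eq0_dominated d (T : measurableType d) (R : realType)
    (mu : {measure set T -> \bar R}) (D : set T) (g h : T -> R) :
  measurable D -> measurable_fun D g -> measurable_fun D h ->
  (forall x, 0 <= g x) -> (forall x, 0 <= h x) -> (forall x, g x = 0 -> h x = 0) ->
  (\int[mu]_(x in D) (g x)%:E = 0)%E -> (\int[mu]_(x in D) (h x)%:E = 0)%E.
Proof.
move=> mD mg mh g0 h0 gh.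
have mgE : measurable_fun D (fun x => (g x)%:E) by exact/measurable_EFinP.
have mhE : measurable_fun D (fun x => (h x)%:E) by exact/measurable_EFinP.
have absE (k : T -> R) : (forall x, 0 <= k x) ->
    (\int[mu]_(x in D) `|(k x)%:E| = \int[mu]_(x in D) (k x)%:E)%E.
  by move=> k0; apply: eq_integral => x _; rewrite gee0_abs// lee_fin.
rewrite -(absE g)// -(absE h)// => /(ae_eq_integral_abs mu mD mgE) g_ae.
apply/(ae_eq_integral_abs mu mD mhE); move: g_ae; apply: filterS => x /= gx Dx.
by have := gx Dx; move=> [] /gh ->.
Qed.

Section degenerate.
Context {R : realType} {n : nat}.
Local Notation mu := (@lebesgue_Rn R n).
Variable Psi : R -> R.
Hypothesis young : young_function Psi.

(** By Young's inequality with [t = 1] every admissible [l] bounds the integral up to a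
    constant factor. *)
Lemma luxemburg_eq0 (Q : set (Rn R n)) (v : R) (f : Rn R n -> R) :
  measurable Q -> 0 < v -> mu Q = v%:E -> measurable_fun setT f ->
  (forall x, 0 <= f x) -> luxemburg Psi Q f = 0%E ->
  (\int[mu]_(x in Q) (f x)%:E = 0)%E.
Proof.
move=> mQ v0 Qv mf f0 lux0.
have P1 : 0 <= associate Psi 1 by rewrite associate_ge0.
pose b := 1 + associate Psi 1; have b0 : 0 < b by rewrite ltr_wpDr.
(* the term [associate Psi 1] of Young's inequality is integrated over all of [Q] *)
have bound l : admissible Psi Q f l -> (\int[mu]_(x in Q) (f x)%:E <= (l * (v * b))%:E)%E.
  move=> adm; have l0 := adm.1; have iF := admissible_integral v0 Qv adm.
  have F0 x : 0 <= Psi (`|f x| / l) by rewrite young_ge0// divr_ge0// ltW.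
  have mF : measurable_fun setT (fun x => Psi (`|f x| / l)).
    by apply: measurable_nondecreasing_comp mf => //; exact: young_le.
  have le x : f x <= l * (Psi (`|f x| / l) + associate Psi 1).
    have := young_ineq young (divr_ge0 (f0 x) (ltW l0)) ler01.
    by rewrite mulr1 ler_pdivrMr// mulrC (ger0_norm (f0 x)).
  apply: le_trans (integral_le_addM mu mQ (ltW l0) (measurable_funTS mF)
    (measurable_cst (associate Psi 1)) F0 (fun=> P1) f0 le) _.
  rewrite [X in (_ + X)%E](_ : _ = ((associate Psi 1)%:E * mu Q)%E); last first.
    exact: (integral_cst mu mQ (associate Psi 1)%:E).
  rewrite Qv EFinM; apply: lee_wpmul2l; first by rewrite lee_fin ltW.
  by rewrite /b mulrDr mulr1 EFinD; apply: leeD => //; rewrite -EFinM mulrC.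
have I0 : (0 <= \int[mu]_(x in Q) (f x)%:E)%E.
  by apply: integral_ge0 => x _; rewrite lee_fin.
have [_ [l a1 _] _] : exists2 x, (EFin @` admissible Psi Q f) x & (x < 0%E + 1%:E)%E.
  by have := @lb_ereal_inf_adherent R (EFin @` admissible Psi Q f) 1 ltr01;
     rewrite -luxemburgE lux0; apply.
have [tau tauE] : exists tau, (\int[mu]_(x in Q) (f x)%:E)%E = tau%:E.
  exists (fine (\int[mu]_(x in Q) (f x)%:E)%E); rewrite fineK// ge0_fin_numE//.
  by apply: le_lt_trans (bound _ a1) (ltry _).
rewrite tauE; congr (_%:E); apply/eqP; rewrite eq_le; apply/andP; split; last first.
  by rewrite -lee_fin -tauE.
have : ((tau / (v * b))%:E <= luxemburg Psi Q f)%E.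
  apply: le_ereal_inf_tmp => _ [l' al' <-]; rewrite lee_fin.
  by rewrite ler_pdivrMr ?mulr_gt0// -lee_fin -tauE bound.
by rewrite lux0 lee_fin ler_pdivrMr ?mulr_gt0// mul0r.
Qed.

Variables (alpha p q : R).
Hypotheses (alpha_gt0 : 0 < alpha) (alpha_ltn : alpha < n%:R).
Hypotheses (p_gt1 : 1 < p) (p_ltq : p < q).
Local Notation p' := (conj_exp p).
Local Notation q' := (conj_exp q).
Variables (u sigma : Rn R n -> R).
Hypotheses (wu : weight u) (wsigma : weight sigma).
Hypothesis A0 : (two_weight_const alpha q' p' Psi sigma u <= 0)%E.

Let u0 x : 0 <= u x. Proof. by case: wu. Qed.
Let sigma0 x : 0 <= sigma x. Proof. by case: wsigma. Qed.
Let mu_ : measurable_fun setT u. Proof. by case: wu. Qed.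
Let msigma : measurable_fun setT sigma. Proof. by case: wsigma. Qed.
Let q_gt1 : 1 < q. Proof. exact: lt_trans p_ltq. Qed.

Lemma degenerate_cube m : (\int[mu]_(x in big_cube m) (sigma x)%:E = 0)%E \/
  (\int[mu]_(x in big_cube m) (u x)%:E = 0)%E.
Proof.
set Q := big_cube m; have cQ : cube Q by exact: cube_big_cube.
have mQ : measurable Q by exact: measurable_big_cube.
pose v : R := (2 * m.+1%:R) ^+ n.
have v0 : 0 < v by rewrite exprn_gt0// mulr_gt0.
have Qv : mu Q = v%:E by rewrite mu_cube_at// mulr_gt0.
have mfq : measurable_fun setT (fun x => u x `^ (conj_exp q')^-1).
  exact: (measurableT_comp (measurable_powR _) mu_).
have : (mu Q `^ (alpha / n%:R + p'^-1 - q'^-1) * average Q (EFin \o sigma) `^ p'^-1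
    * luxemburg Psi Q (fun x => (u x `^ (conj_exp q')^-1)%R) <= 0)%E.
  by apply: le_trans A0; apply: ereal_sup_ubound; exists Q.
have s0 : (0 <= \int[mu]_(x in Q) (sigma x)%:E)%E.
  by apply: integral_ge0 => x _; rewrite lee_fin.
have av0 : (0 <= average Q (EFin \o sigma))%E.
  by rewrite mule_ge0// lee_fin invr_ge0 Qv ltW.
have l0 := luxemburg_ge0 Psi Q (fun x => (u x `^ (conj_exp q')^-1)%R).
move=> le0.
have : (mu Q `^ (alpha / n%:R + p'^-1 - q'^-1) * average Q (EFin \o sigma) `^ p'^-1
    * luxemburg Psi Q (fun x => (u x `^ (conj_exp q')^-1)%R) == 0)%E.
  by rewrite eq_le le0 mule_ge0// mule_ge0// poweR_ge0.
rewrite !mule_eq0 => /orP[/orP[]|/eqP lux0].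
- by rewrite Qv poweR_EFin eqe gt_eqF// powR_gt0.
- rewrite poweR_eq0// => /andP[+ _]; rewrite /average mule_eq0 => /orP[|/eqP ->].
    by rewrite Qv eqe gt_eqF// invr_gt0.
  by left.
right; have uq0 (x : Rn R n) : 0 <= u x `^ (conj_exp q')^-1 by exact: powR_ge0.
have uq (x : Rn R n) : u x `^ (conj_exp q')^-1 = 0 -> u x = 0 by exact: powR_eq0_eq0.
exact: (integral_eq0_dominated mQ (measurable_funTS mfq) (measurable_funTS mu_)
  uq0 u0 uq (luxemburg_eq0 mQ v0 Qv mfq uq0 lux0)).
Qed.

Lemma big_cube_integral_eq0 (w : Rn R n -> R) m0 : measurable_fun setT w ->
  (forall x, 0 <= w x) ->
  (forall m, (m0 <= m)%N -> (\int[mu]_(x in big_cube m) (w x)%:E = 0)%E) ->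
  (\int[mu]_x (w x)%:E = 0)%E.
Proof.
move=> mw w0 wm.
have nd : nondecreasing_seq (fun m => @big_cube R n m).
  by move=> m m' mm'; apply/subsetPset; exact: big_cube_homo.
have -> : [set: Rn R n] = \bigcup_m big_cube m.
  by apply/seteqP; split => // x _; have [m xm] := big_cube_cover x; exists m.
have w0E m x : big_cube m x -> (0 <= (w x)%:E)%E by rewrite lee_fin.
have cv := @ge0_nondecreasing_set_cvg_integral _ _ _ _ (fun x => (w x)%:E) mu nd
  (@measurable_big_cube R n) (fun m => measurable_funTS ((measurable_EFinP _ _).2 mw))
  w0E.
rewrite -(cvg_lim _ cv)//; apply: lim_near_cst => //.
by near=> m; apply: wm; near: m; exists m0.
Unshelve. all: by end_near. Qed.

(** If [sigma] charges some cube, it charges all the larger ones, and [u] vanishes on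
    these. *)
Lemma degenerate_weights : (\int[mu]_x (sigma x)%:E = 0)%E \/ (\int[mu]_x (u x)%:E = 0)%E.
Proof.
have [sm|/existsNP[m1 sm1]] := pselect (forall m,
    (\int[mu]_(x in big_cube m) (sigma x)%:E = 0)%E).
  by left; apply: (@big_cube_integral_eq0 _ 0).
right; apply: (@big_cube_integral_eq0 _ m1) => // m m1m.
have [sm|//] := degenerate_cube m; case: sm1; apply/eqP; rewrite eq_le -{1}sm.
apply/andP; split.
  by apply: le_integral_setS => [|x _]; [exact: big_cube_homo|rewrite lee_fin].
by apply: integral_ge0 => x _; rewrite lee_fin.
Qed.

Lemma degenerate_weak (f : Rn R n -> R) : measurable_fun setT f ->
  (forall x, 0 <= f x) ->
  (weak_Lq_norm q u (riesz_potential alpha (fun x => (f x * sigma x)%R)) <= 0)%E.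
Proof.
move=> mf f0; apply: ge_ereal_sup => _ [s /= s0 <-].
set E := [set x | _].
suff -> : (\int[mu]_(x in E) (u x)%:E = 0)%E.
  by rewrite poweR0r ?mule0// invr_eq0 gt_eqF// (lt_trans _ q_gt1).
have [sig0|uu0] := degenerate_weights; last first.
  apply/eqP; rewrite eq_le -{1}uu0; apply/andP; split.
    by apply: le_integral_setS => // x _; rewrite lee_fin.
  by apply: integral_ge0 => x _; rewrite lee_fin.
pose phi (x : Rn R n) : R := f x * sigma x.
have mphi : measurable_fun setT phi by exact: measurable_funM.
have phi0 x : 0 <= phi x by exact: mulr_ge0.
have phi_int0 : (\int[mu]_x (phi x)%:E = 0)%E.
  have phi_sig x : sigma x = 0 -> phi x = 0 by rewrite /phi => ->; rewrite mulr0.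
  exact: (integral_eq0_dominated measurableT msigma mphi sigma0 phi0 phi_sig sig0).
suff -> : E = set0 by rewrite integral_set0.
apply/seteqP; split => // x; rewrite /E /=.
rewrite gee0_abs; last exact: riesz_ge0.
move=> /(riesz_le_truncated alpha_ltn mphi phi0)[m].
suff -> : truncated alpha phi m x = 0%E by rewrite mule0 lte_fin ltNge (ltW s0).
have cell0 t k : scale_term alpha phi x t k = 0%E.
  rewrite /scale_term (_ : (\int[mu]_(y in _) _ = 0)%E) ?mule0//.
  apply/eqP; rewrite eq_le -{1}phi_int0; apply/andP; split.
    by apply: le_integral_setS => // y _; rewrite lee_fin.
  by apply: integral_ge0 => y _; rewrite lee_fin.
by rewrite /truncated big1// => j _; rewrite big1// => t _; rewrite !cell0 adde0.
Qed.

End degenerate.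

(** * The theorem *)

Section op_norm_facts.
Context {R : realType} {n : nat}.
Variables (D : set (Rn R n -> R)) (N1 : (Rn R n -> R) -> \bar R).
Variables (N2 : (Rn R n -> \bar R) -> \bar R) (T : (Rn R n -> R) -> Rn R n -> \bar R).
Local Open Scope ereal_scope.

Lemma op_norm_ge0 : 0 <= op_norm D N1 N2 T.
Proof. by apply: le_ereal_inf_tmp => _ [C [C0 _] <-]; rewrite lee_fin. Qed.

Lemma op_norm_le C : (0 <= C)%R ->
  (forall f, D f -> N1 f < +oo -> N2 (T f) <= C%:E * N1 f) ->
  op_norm D N1 N2 T <= C%:E.
Proof. by move=> C0 h; apply: ereal_inf_lbound; exists C. Qed.

(** Passing to the infimum over the admissible constants of the operator norm, which may
    be an empty set. *)
Lemma le_mul_op_norm (x : \bar R) (k : R) : (0 < k)%R ->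
  (forall C, (0 <= C)%R ->
    (forall f, D f -> N1 f < +oo -> N2 (T f) <= C%:E * N1 f) ->
    x <= (k * C)%:E) ->
  x <= k%:E * op_norm D N1 N2 T.
Proof.
move=> k0 h; rewrite muleC -lee_pdivrMr//; apply: le_ereal_inf_tmp => _ [C [C0 hC] <-].
by rewrite lee_pdivrMr// -EFinM mulrC; exact: h.
Qed.

End op_norm_facts.

Theorem theorem3p5 (R : realType) (n : nat) (alpha p q : R)
    (alpha_gt0 : 0 < alpha) (alpha_ltn : alpha < n%:R)
    (p_gt1 : 1 < p) (p_ltq : p < q) :
  let beta := n%:R * (p^-1 - q^-1) in
  let p' := conj_exp p in
  let q' := conj_exp q in
  exists c : R, 0 < c /\
    forall (Psi : R -> R) (u sigma : Rn R n -> R),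
      young_function Psi ->
      B_class (n := n) beta q' (associate Psi) ->
      weight u -> weight sigma ->
      (two_weight_const alpha q' p' Psi sigma u < +oo)%E ->
      (riesz_weak_norm alpha p q sigma u <=
        c%:E * (two_weight_const alpha q' p' Psi sigma u
                * orlicz_maximal_norm (n := n) beta q' p' (associate Psi)))%E.
Proof.
move=> beta p' q'.
have wc0 := @weak_const_ge0 R n alpha p q.
exists (weak_const (n := n) alpha p q + 1); split; first by rewrite ltr_wpDl.
move=> Psi u sigma young _ wu wsigma Afin.
set A := two_weight_const _ _ _ _ _ _ in Afin *.
have M0 : (0 <= orlicz_maximal_norm (n := n) beta q' p' (associate Psi))%E.
  exact: op_norm_ge0.
have [A_le0|A_gt0] := leP A 0%E.
  apply: (@le_trans _ _ 0%E).
    apply: op_norm_le => // f [mf f0] _; rewrite mul0e.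
    exact: (degenerate_weak young alpha_ltn p_gt1 p_ltq wu wsigma A_le0 mf f0).
  rewrite mule_ge0//; first by rewrite lee_fin addr_ge0.
  rewrite mule_ge0//.
  have cQ : cube (@big_cube R n 0) by exact: cube_big_cube.
  apply: le_trans (ereal_sup_ubound _); last by exists (big_cube 0).
  rewrite mule_ge0 ?luxemburg_ge0// mule_ge0 ?poweR_ge0//.
have [a aE] : exists a, A = a%:E.
  by exists (fine A); rewrite fineK// gt0_fin_numE.
have a0 : 0 < a by rewrite -lte_fin -aE.
rewrite aE muleA -EFinM; apply: le_mul_op_norm.
  by rewrite mulr_gt0// ltr_wpDl.
move=> C C0 HC.
apply: (@le_trans _ _ ((weak_const (n := n) alpha p q * a * C)%:E)); last first.
  by rewrite lee_fin ler_wpM2r// ler_wpM2r ?(ltW a0)// lerDl.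
apply: op_norm_le; first by rewrite mulr_ge0// mulr_ge0// ltW.
move=> f [mf f0] fin.
have [F FE] : exists F, Lp_norm p sigma f = F%:E.
  exists (fine (Lp_norm p sigma f)); rewrite fineK// ge0_fin_numE//.
  exact: poweR_ge0.
rewrite FE -EFinM.
apply: (weak_estimate alpha_gt0 alpha_ltn p_gt1 p_ltq young wu wsigma a0 C0 _ HC mf f0 FE).
by rewrite -/A aE.
Qed.
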